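(* Let $\alpha_4,\dots,\alpha_n,\theta\in\mathbb{C}$, and let $L=F_1(\alpha_4,\alpha_5,\dots,\alpha_n,\theta)$ be the $n$-dimensional algebra of the first family, with basis $e_1,\dots,e_n$. The pre-derivations $P$ of $L$ have the following form, with complex numbers $a_1,\dots,a_n,b_{n-1},b_n,c_2,\dots,c_n$: $$P(e_1)=\sum_{t=1}^{n}a_te_t,\qquad P(e_2)=(a_1+a_2)e_2+\sum_{t=3}^{n-2}a_te_t+b_{n-1}e_{n-1}+b_ne_n,\qquad P(e_3)=\sum_{t=2}^{n}c_te_t,$$ $$P(e_{2i})=((2i-1)a_1+a_2)e_{2i}+\sum_{t=2i+1}^{n}\big(a_{t-2i+2}+(2i-2)a_2\alpha_{t-2i+3}\big)e_t,\qquad 2\le i\le\lfloor n/2\rfloor,$$ $$P(e_{2i+1})=c_2e_{2i}+((2i-2)a_1+c_3)e_{2i+1}+\sum_{t=2i+2}^{n}\big(c_{t-2i+2}+(2i-2)a_2\alpha_{t-2i+2}\big)e_t,\qquad 2\le i\le\lfloor (n-1)/2\rfloor,$$ where the following restrictions hold: (1) $(1+(-1)^n)c_2=0$, and $c_2\alpha_t=0$ for $4\le t\le n-1$; (2) $(a_1-a_2)\alpha_4=0$ and $(3a_1-c_3)\alpha_4=0$; (3) $\sum_{t=3}^{k}(a_{2k-2t+3}-c_{2k-2t+4}+a_2\alpha_{2k-2t+4})\alpha_{2t-2}=0$ for $3\le k\le\lfloor\frac{n-1}{2}\rfloor$; (4) $(2a_1+a_2-c_3)\alpha_{2k}+\sum_{t=3}^{k}(a_{2k-2t+4}-c_{2k-2t+5}+a_2\alpha_{2k-2t+5})\alpha_{2t-2}=0$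 for $3\le k\le\lfloor\frac n2\rfloor-1$; (5) $(a_2-(k-3)a_1)\alpha_k=\frac{k-1}{2}a_2\sum_{t=5}^{k}\alpha_{t-1}\alpha_{k-t+4}$ for $5\le k\le n-2$; (6) if $n$ is even, $(a_2-(n-4)a_1)\alpha_{n-1}=a_2\sum_{t=3}^{(n-2)/2}(2t-3)\alpha_{n-2t+3}\alpha_{2t-1}+\sum_{t=2}^{(n-2)/2}(c_{n-2t+2}-a_{n-2t+1}+(2t-3)a_2\alpha_{n-2t+2})\alpha_{2t}$; (7) if $n$ is odd, $(2a_2-c_3-(n-6)a_1)\alpha_{n-1}=a_2\sum_{t=3}^{(n-1)/2}(2t-3)\alpha_{n-2t+3}\alpha_{2t-1}+\sum_{t=2}^{(n-3)/2}(c_{n-2t+2}-a_{n-2t+1}+(2t-3)a_2\alpha_{n-2t+2})\alpha_{2t}$.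
   Context: A (right) Leibniz algebra is a vector space $L$ with a bilinear bracket satisfying $[[x,y],z]=[[x,z],y]+[x,[y,z]]$ for all $x,y,z\in L$. A pre-derivation of $L$ is a linear map $P:L\to L$ with $P([[x,y],z])=[[P(x),y],z]+[[x,P(y)],z]+[[x,y],P(z)]$ for all $x,y,z\in L$. For $\alpha_4,\dots,\alpha_n,\theta\in\mathbb{C}$, $F_1(\alpha_4,\dots,\alpha_n,\theta)$ is the $n$-dimensional complex (filiform) Leibniz algebra with basis $e_1,\dots,e_n$ and products $[e_1,e_1]=e_3$; $[e_i,e_1]=e_{i+1}$ for $2\le i\le n-1$; $[e_1,e_2]=\sum_{t=4}^{n-1}\alpha_te_t+\theta e_n$; $[e_j,e_2]=\sum_{t=j+2}^{n}\alpha_{t-j+2}e_t$ for $2\le j\le n-2$; all omitted products of basis elements are zero. Empty sums are zero and $\lfloor a\rfloor$ denotes the integer part of the real number $a$.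
   Formalization: The dimension is assumed to satisfy n ≥ 6: for n = 5 with α_4 ≠ 0 restriction (2) is not necessary (e.g. α_4 = 1, α_5 = θ = 0, P = diag(1,1,1,3,3)), and for n ≤ 4 the restrictions involve undefined coefficients such as α_3. *)

(* Defs.v *)
From mathcomp Require Import all_boot all_order all_algebra.

Set Implicit Arguments.
Unset Strict Implicit.
Unset Printing Implicit Defensive.

Import GRing.Theory.
Local Open Scope ring_scope.

Section Leibniz.
Variables (F : fieldType) (V : lmodType F).

Record is_leibniz (br : V -> V -> V) : Prop := IsLeibniz {
  bracket_linearl : forall y, linear (br^~ y);
  bracket_linearr : forall x, linear (br x);
  right_leibniz : forall x y z, br (br x y) z = br (br x z) y + br x (br y z)
}.

Definition is_prederivation (br : V -> V -> V) (P : {linear V -> V}) : Prop :=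
  forall x y z,
    P (br (br x y) z) =
      br (br (P x) y) z + br (br x (P y)) z + br (br x y) (P z).

End Leibniz.

(* The basis is indexed from 1: [e_ n i] is nonzero exactly when 1 <= i <= n. *)
Definition e_ {F : fieldType} (n i : nat) : 'rV[F]_n :=
  \row_(k < n) (k.+1 == i)%:R.

(* Only alpha 4, ..., alpha n are read; in the last sum t >= i + 2, so the
   truncated subtraction t - i is exact. *)
Definition F1_prod (F : fieldType) (n : nat) (alpha : nat -> F) (theta : F)
    (i j : nat) : 'rV[F]_n :=
  match j with
  | 1%N => if (i == 1)%N then e_ n 3
           else if (2 <= i <= n.-1)%N then e_ n i.+1
           else 0
  | 2%N => if (i == 1)%N then
             \sum_(4 <= t < n) alpha t *: e_ n t + theta *: e_ n n
           else if (2 <= i <= n - 2)%N then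
             \sum_(i + 2 <= t < n.+1) alpha (t - i + 2)%N *: e_ n t
           else 0
  | _ => 0
  end.

Definition F1 (F : fieldType) (n : nat) (alpha : nat -> F) (theta : F)
    (x y : 'rV[F]_n) : 'rV[F]_n :=
  \sum_(i < n) \sum_(j < n)
    (x 0 i * y 0 j) *: F1_prod n alpha theta i.+1 j.+1.

Section F1Theory.
Variables (F : fieldType) (n : nat) (alpha : nat -> F) (theta : F).
Local Notation br := (@F1 F n alpha theta).
Local Notation prod := (F1_prod n alpha theta).
Local Notation e := (@e_ F n).

Lemma F1_linearl y : linear (br^~ y).
Proof.
move=> a u v; rewrite /F1 scaler_sumr -big_split /=; apply: eq_bigr => i _.
rewrite scaler_sumr -big_split /=; apply: eq_bigr => j _.
by rewrite !mxE mulrDl scalerDl scalerA mulrA.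
Qed.

Lemma F1_linearr x : linear (br x).
Proof.
move=> a u v; rewrite /F1 scaler_sumr -big_split /=; apply: eq_bigr => i _.
rewrite scaler_sumr -big_split /=; apply: eq_bigr => j _.
by rewrite !mxE mulrDr scalerDl scalerA mulrCA.
Qed.

Lemma F1_suml (I : Type) (r : seq I) (p : pred I) (c : I -> F)
    (v : I -> 'rV[F]_n) y :
  br (\sum_(i <- r | p i) c i *: v i) y = \sum_(i <- r | p i) c i *: br (v i) y.
Proof.
have br0 : br 0 y = 0.
  rewrite /F1 big1 // => i _; rewrite big1 // => j _.
  by rewrite mxE mul0r scale0r.
elim/big_rec2: _ => // i u w _ <-; exact: F1_linearl.
Qed.

Lemma F1_sumr (I : Type) (r : seq I) (p : pred I) (c : I -> F)
    (v : I -> 'rV[F]_n) x :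
  br x (\sum_(i <- r | p i) c i *: v i) = \sum_(i <- r | p i) c i *: br x (v i).
Proof.
have br0 : br x 0 = 0.
  rewrite /F1 big1 // => i _; rewrite big1 // => j _.
  by rewrite mxE mulr0 scale0r.
elim/big_rec2: _ => // i u w _ <-; exact: F1_linearr.
Qed.

Lemma e_sum (x : 'rV[F]_n) : x = \sum_(i < n) x 0 i *: e i.+1.
Proof.
apply/rowP => k; rewrite summxE (bigD1 k) //= !mxE eqxx mulr1 big1 ?addr0 //.
by move=> i ik; rewrite !mxE eqSS val_eqE eq_sym (negPf ik) mulr0.
Qed.

Lemma F1_e i j : (0 < i <= n)%N -> (0 < j <= n)%N -> br (e i) (e j) = prod i j.
Proof.
case: i j => [|i] [|j] // hi hj; rewrite /F1.
move: (F1_prod n alpha theta) => f.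
rewrite (bigD1 (Ordinal hi)) //= (bigD1 (Ordinal hj)) //= !mxE !eqxx.
rewrite mulr1 scale1r big1 ?addr0 => [|k /negPf hk]; last first.
  by rewrite !mxE /= !eqSS -[k == j :> nat]/(k == Ordinal hj) hk mulr0 scale0r.
rewrite big1 ?addr0 // => k /negPf hk; rewrite big1 // => l _.
by rewrite !mxE !eqSS -[k == i :> nat]/(k == Ordinal hi) hk mul0r scale0r.
Qed.

End F1Theory.

Lemma F1_leibniz (F : fieldType) (n : nat) (alpha : nat -> F) (theta : F) :
  (3 <= n)%N -> is_leibniz (@F1 F n alpha theta).
Proof.
move=> n3; split; [exact: F1_linearl | exact: F1_linearr |].
set br := @F1 F n alpha theta; set prod := F1_prod n alpha theta.
have pr3 i j : (2 < j)%N -> prod i j = 0 by case: j => [|[|[|j]]].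
have brr3 x j : (2 < j <= n)%N -> br x (e_ n j) = 0.
  case/andP=> j2 jn; rewrite [x]e_sum /br F1_suml big1 // => i _.
  by rewrite F1_e ?ltn_ord ?jn ?(ltn_trans _ j2) // -/prod pr3 ?scaler0.
have coord i j (k : 'I_n) : (k < 2)%N -> prod i j 0 k = 0.
  move=> k2; have ez t : (2 < t)%N -> e_ n t 0 k = 0 :> F.
    move=> t2; rewrite mxE; case: eqP => // kt; move: t2.
    by rewrite -kt ltnS ltnNge -ltnS k2.
  rewrite /prod /F1_prod.
  case: j => [|[|[|j]]]; rewrite ?mxE //.
    case: ifP => _; first exact: ez.
    by case: ifP => [/andP[i2 _]|_]; [exact: ez | rewrite mxE].
  case: ifP => _.
    rewrite mxE summxE [X in _ + X]mxE ez // mulr0 addr0 big_nat big1 //.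
    by move=> t /andP[t4 _]; rewrite mxE ez ?mulr0 // (leq_trans _ t4).
  case: ifP => [/andP[i2 _]|_]; last by rewrite mxE.
  rewrite summxE big_nat big1 // => t /andP[t4 _]; rewrite mxE ez ?mulr0 //.
  by rewrite (leq_trans _ t4) // addn2 !ltnS ltnW.
have brr x y z : br x (br y z) = 0.
  rewrite [br y z]e_sum /br F1_sumr -/br big1 // => k _.
  case: (ltnP k 2) => k2; last by rewrite brr3 ?scaler0 // ltnS k2 ltn_ord.
  rewrite /br /F1 summxE big1 ?scale0r // => i _; rewrite summxE big1 // => j _.
  by rewrite mxE coord ?mulr0.
have b0 y : br 0 y = 0.
  have := F1_suml alpha theta [::] xpredT (fun _ : unit => 0) (fun=> 0) y.
  by rewrite !big_nil.
have comm12 x : br (br x (e_ n 1)) (e_ n 2) = br (br x (e_ n 2)) (e_ n 1).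
  rewrite [x]e_sum /br !F1_suml -/br; apply: eq_bigr => i _; congr (_ *: _).
  have n1 : (1 <= n)%N by rewrite (leq_trans _ n3).
  have n2 : (2 <= n)%N by rewrite (leq_trans _ n3).
  have e1 j : (2 <= j < n)%N -> br (e_ n j) (e_ n 1) = e_ n j.+1.
    move=> /andP[j2 jn]; rewrite /br F1_e ?(ltnW jn) ?(ltn_trans _ j2) //=.
    have -> : (j <= n.-1)%N by rewrite -ltnS prednK.
    by rewrite j2; case: eqP j2 => // ->.
  have en1 : br (e_ n n) (e_ n 1) = 0.
    rewrite /br F1_e ?leqnn ?n1 //=.
    have -> : (n <= n.-1)%N = false by rewrite leqNgt prednK // leqnn.
    by rewrite andbF; case: eqP n2 => // ->.
  have e2 j : (2 <= j <= n)%N -> br (e_ n j) (e_ n 2) =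
      \sum_(j + 2 <= t < n.+1) alpha (t - j + 2)%N *: e_ n t.
    move=> /andP[j2 jn]; rewrite /br F1_e ?jn ?(ltn_trans _ j2) //= j2 /=.
    case: eqP j2 => [-> //|_ j2]; case: leqP => // jn2.
    by rewrite big_geq // addn2 ltnS; move: jn2; rewrite ltn_subLR // add2n.
  have bA m (c : nat -> F) : (2 <= m)%N ->
     br (\sum_(m <= t < n) c t *: e_ n t) (e_ n 1) =
     \sum_(m.+1 <= t < n.+1) c t.-1 *: e_ n t.
    move=> m2; rewrite /br F1_suml -/br big_add1 /= big_nat [RHS]big_nat.
    apply: eq_bigr => t /andP[mt tn]; congr (_ *: _).
    by rewrite e1 // tn (leq_trans m2 mt).
  have lin u c : br (u + c *: e_ n n) (e_ n 1) = br u (e_ n 1).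
    rewrite addrC /br F1_linearl -/br en1 scaler0 add0r //.
  have [i0|i1] := posnP i.
    have e11 : br (e_ n 1) (e_ n 1) = e_ n 3 by rewrite /br F1_e ?n1.
    have e12 : br (e_ n 1) (e_ n 2) =
        \sum_(4 <= t < n) alpha t *: e_ n t + theta *: e_ n n.
      by rewrite /br F1_e ?n1 ?n2.
    rewrite i0 e11 e12 lin bA // e2 ?n3 //.
    rewrite big_nat [RHS]big_nat; apply: eq_bigr => t /andP[t5 _].
    by congr (alpha _ *: _); case: t t5 => [|[|[|t]]] // _; rewrite !subSS subn0 addn2.
  rewrite (e2 i.+1) ?ltnS ?i1 ?ltn_ord //.
  have [iN|iN] := ltnP i.+2 n; last first.
    rewrite [in RHS]big_geq ?addn2 // b0.
    case: (ltnP i.+1 n) => [iN1|iN1].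
      by rewrite e1 ?iN1 ?ltnS ?i1 // e2 ?iN1 // big_geq // addn2 ltnS ltnW.
    have -> : i.+1 = n by apply/eqP; rewrite eqn_leq iN1 ltn_ord.
    by rewrite en1 b0.
  rewrite e1 ?ltnS ?i1 ?(ltnW iN) // e2 ?(ltnW iN) //.
  rewrite [X in _ = br X _]big_nat_recr /=; last by rewrite addn2.
  rewrite lin bA ?addn2 // big_nat [RHS]big_nat; apply: eq_bigr => t.
  by case: t => // t /andP[t1 _]; congr (alpha _ *: _).
have comm x j k : (0 < j <= n)%N -> (0 < k <= n)%N ->
    br (br x (e_ n j)) (e_ n k) = br (br x (e_ n k)) (e_ n j).
  case: j k => [|[|[|j]]] [|[|[|k]]] //= hj hk;
    rewrite ?comm12 // ?[br _ (e_ n k.+3)]brr3 // ?[br _ (e_ n j.+3)]brr3 ?b0 //.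
move=> x y z; rewrite brr addr0.
rewrite [y]e_sum [z]e_sum /br !F1_sumr -/br.
under eq_bigr do rewrite /br F1_suml -/br scaler_sumr.
under [RHS]eq_bigr do rewrite /br F1_suml -/br scaler_sumr.
rewrite exchange_big; apply: eq_bigr => i _; apply: eq_bigr => j _ /=.
by rewrite comm ?ltn_ord // !scalerA mulrC.
Qed.

(* Main.v *)
(** Identify the span of [e_2, ..., e_n] with [F[X]/(X^(n-1))] through
    [e_t = X^(t-2)], and let [A] be the sum of the [alpha_s X^(s-2)], s >= 4.
    Right multiplication by [e_1] (resp. [e_2]) acts there as multiplication by
    [X] (resp. [A]), and [e_1 - e_2] annihilates every triple product, so that
    [[x, y], z] = x y z as truncated polynomials, [e_1] being read as 1 on the
    left, [e_1], [e_2] as [X], [A] on the right, and [e_j], j >= 3, as 0 on the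
    right; [theta] plays no role.  Writing d0, d1, m for the polynomials of
    [P e_2], [P e_3] and the right multiplication by [P e_1], the relation for
    the triples (x, e_1, e_1) determines [P] on [F[X]/(X^(n-1))] as
      [D g = d0 g + m g' + h g_odd / X], with [h = d1 - m - X d0].
    The remaining relations reduce to [c_2 X A = 0], [h X A_even = 0] and
    [X m A' + h A_even = (a_1 + a_2) X A] modulo [X^(n-1)], whose coefficients
    are the restrictions (1)-(7). *)
From HB Require Import structures.
Require Import Defs.
From mathcomp Require Import all_boot all_order all_algebra.
From mathcomp Require Import reals.
From mathcomp Require Import complex.
From mathcomp Require Import zify ring.

Set Implicit Arguments.
Unset Strict Implicit.
Unset Printing Implicit Defensive.

Import GRing.Theory.
Local Open Scope ring_scope.

(** * Even and odd parts of polynomials *)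

Section Parity.
Variable F : fieldType.
Implicit Types p q : {poly F}.

(** [even_poly] and [odd_poly] halve exponents, and substituting ['X^2] restores them. Thus [odp p]
    is the odd part of [p] divided by ['X], again an even polynomial. *)
Definition evp p := even_poly p \Po 'X^2.
Definition odp p := odd_poly p \Po 'X^2.

Lemma evp_odp p : evp p + odp p * 'X = p.
Proof. exact: poly_even_odd. Qed.

Lemma coef_evp p i : (evp p)`_i = if odd i then 0 else p`_i.
Proof.
rewrite /evp coef_comp_poly_Xn // coef_even_poly dvdn2 divn2.
by case: (boolP (odd i)) => //= io; rewrite halfK (negbTE io) subn0.
Qed.

Lemma coef_odp p i : (odp p)`_i = if odd i then 0 else p`_i.+1.
Proof.
rewrite /odp coef_comp_poly_Xn // coef_odd_poly dvdn2 divn2.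
by case: (boolP (odd i)) => //= io; rewrite halfK (negbTE io) subn0.
Qed.

Lemma odp_linear : linear odp.
Proof.
move=> k p q; apply/polyP => i; rewrite coefD coefZ !coef_odp coefD coefZ.
by case: ifP; rewrite ?mulr0 ?addr0.
Qed.

Lemma even_odd_poly_unique p q :
  even_poly (p \Po 'X^2 + (q \Po 'X^2) * 'X) = p /\
  odd_poly (p \Po 'X^2 + (q \Po 'X^2) * 'X) = q.
Proof.
have c0 r i : (r \Po 'X^2)`_i.*2 = r`_i.
  by rewrite coef_comp_poly_Xn // dvdn2 odd_double divn2 doubleK.
have c1 r i : (r \Po 'X^2)`_i.*2.+1 = 0.
  by rewrite coef_comp_poly_Xn // dvdn2 /= odd_double.
split; apply/polyP => i; rewrite ?coef_even_poly ?coef_odd_poly coefD coefMX.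
  by rewrite c0; case: i => [|i] /=; rewrite ?addr0 // c1 addr0.
by rewrite c1 add0r /= c0.
Qed.

(** Sorting the product of the two decompositions by parity gives a polynomial in ['X^2] plus ['X]
    times another; such a decomposition is unique, so both halves are read off at once. *)
Lemma evp_odp_mul p q :
  evp (p * q) = evp p * evp q + 'X^2 * odp p * odp q /\
  odp (p * q) = evp p * odp q + odp p * evp q.
Proof.
have -> : p * q =
    ((even_poly p * even_poly q + 'X * odd_poly p * odd_poly q) \Po 'X^2) +
    ((even_poly p * odd_poly q + odd_poly p * even_poly q) \Po 'X^2) * 'X.
  rewrite !(comp_polyD, comp_polyM) comp_polyX.
  rewrite -{1}[p]evp_odp -{1}[q]evp_odp /evp /odp; ring.
rewrite /evp /odp; have [-> ->] := even_odd_poly_unique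
  (even_poly p * even_poly q + 'X * odd_poly p * odd_poly q)
  (even_poly p * odd_poly q + odd_poly p * even_poly q).
by rewrite !(comp_polyD, comp_polyM) comp_polyX.
Qed.

Lemma evpM p q : evp (p * q) = evp p * evp q + 'X^2 * odp p * odp q.
Proof. by case: (evp_odp_mul p q). Qed.

Lemma odpM p q : odp (p * q) = evp p * odp q + odp p * evp q.
Proof. by case: (evp_odp_mul p q). Qed.

Lemma evpX : evp 'X = 0.
Proof. by apply/polyP => i; rewrite coef_evp coefX coef0; case: i => [|[|i]] //=; case: ifP. Qed.

Lemma odpX : odp 'X = 1.
Proof. by apply/polyP => i; rewrite coef_odp coefX coef1; case: i => [|[|i]] //=; case: ifP. Qed.

Lemma odpXn k : odp 'X^k = if odd k then 'X^(k.-1) else 0.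
Proof.
apply/polyP => i; rewrite coef_odp coefXn.
case: ifP => io; case: ifP => ko; rewrite ?coefXn ?coef0 //.
- by case: k ko => //= k ko; case: eqP => // ik; rewrite ik (negbTE ko) in io.
- by case: k ko => //.
- by case: eqP => // ik; rewrite -ik /= io in ko.
Qed.

End Parity.

Lemma coef_sum_e (F : fieldType) n m (b : nat -> F) (k : 'I_n) :
  (\sum_(m <= t < n.+1) b t *: e_ n t) 0 k = if (m <= k.+1)%N then b k.+1 else 0.
Proof.
rewrite summxE; case: ifP => hk.
  rewrite (bigD1_seq k.+1) ?iota_uniq ?mem_index_iota ?hk ?ltnS ?ltn_ord //=.
  rewrite !mxE eqxx mulr1 big1 ?addr0 // => t tk.
  by rewrite !mxE eq_sym (negbTE tk) mulr0.
rewrite big_nat big1 // => t ht; rewrite !mxE.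
by rewrite (_ : (k.+1 == t) = false) ?mulr0 //; lia.
Qed.

(** * The polynomial model of the algebra *)

Section Model.
Variables (F : fieldType) (n : nat) (alpha : nat -> F) (theta : F).
Local Notation br := (@F1 F n alpha theta).
Local Notation e := (@e_ F n).
Implicit Types (x y z : 'rV[F]_n) (g p q : {poly F}).

(* [e_2, ..., e_n] span a copy of F[X]/(X^(n-1)), with [e_t] standing for
   [X^(t-2)]; [emb] is the projection from F[X] onto this subspace. *)
Definition emb g : 'rV[F]_n :=
  \row_(k < n) if k == 0%N :> nat then 0 else g`_k.-1.

(* The truncated [k.-1] sends both [e_1] and [e_2] to 1. *)
Definition res x : {poly F} := \sum_(k < n) x 0 k *: 'X^(k.-1).

(** This polynomial stands for [e_2, e_2]; [e_1, e_2] can differ from it only in the coefficient of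
    e_n. *)
Definition gen2 : {poly F} := \poly_(j < n.-1) if (1 < j)%N then alpha j.+2 else 0.

(* Up to a term in the line of [e_n], right multiplication by [y] is
   multiplication by [rmul y]. *)
Definition rmul y : {poly F} :=
  \sum_(k < n) y 0 k *: (match val k with 0 => 'X | 1 => gen2 | _ => 0 end).

Lemma emb_linear : linear emb.
Proof.
move=> k p q; apply/rowP => i; rewrite !mxE coefD coefZ.
by case: ifP; rewrite ?mulr0 ?addr0.
Qed.
HB.instance Definition _ := GRing.isLinear.Build F {poly F} 'rV[F]_n _ emb emb_linear.

Lemma res_linear : linear res.
Proof.
move=> k x y; rewrite /res scaler_sumr -big_split; apply: eq_bigr => i _ /=.
by rewrite !mxE scalerDl scalerA.
Qed.
HB.instance Definition _ := GRing.isLinear.Build F 'rV[F]_n {poly F} _ res res_linear.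

Lemma rmul_linear : linear rmul.
Proof.
move=> k x y; rewrite /rmul scaler_sumr -big_split; apply: eq_bigr => i _ /=.
by rewrite !mxE scalerDl scalerA.
Qed.
HB.instance Definition _ := GRing.isLinear.Build F 'rV[F]_n {poly F} _ rmul rmul_linear.

Lemma emb_eq0 g : emb g = 0 <-> (forall j, (j.+1 < n)%N -> g`_j = 0).
Proof.
split=> [/rowP g0 j jn|g0]; first by have := g0 (Ordinal jn); rewrite !mxE.
by apply/rowP => -[[|k] kn]; rewrite !mxE //= g0.
Qed.

(** The kernel of [emb] is the ideal generated by ['X^(n.-1)]. *)
Lemma emb_mull p q : emb p = 0 -> emb (q * p) = 0.
Proof.
move=> /emb_eq0 p0; apply/emb_eq0 => j jn; rewrite coefM big1 // => i _.
by rewrite p0 ?mulr0 // (leq_ltn_trans _ jn) // ltnS leq_subr.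
Qed.

Lemma emb_eqP p q : emb p = emb q <-> emb (p - q) = 0.
Proof. by rewrite raddfB /=; split=> [->|/eqP]; rewrite ?subrr // subr_eq0 => /eqP. Qed.

Lemma emb_Xn k : emb 'X^k = e k.+2.
Proof.
by apply/rowP => -[[|i] hi]; rewrite !mxE //= coefXn eqSS.
Qed.

Lemma coef_res_emb g j : (j.+1 < n)%N -> (res (emb g))`_j = g`_j.
Proof.
move=> jn; rewrite coef_sum (bigD1 (Ordinal jn)) //= coefZ coefXn eqxx mulr1 mxE /=.
rewrite big1 ?addr0 // => i; rewrite mxE coefZ coefXn -val_eqE /=.
case: (eqVneq (i : nat) 0) => [|i0] ij; first by rewrite mul0r.
have -> : (j == i.-1) = false by lia.
by rewrite mulr0.
Qed.

Lemma emb_res_emb p g : emb (res (emb g) * p) = emb (g * p).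
Proof.
apply/emb_eqP; rewrite -mulrBl mulrC; apply/emb_mull/emb_eq0 => j jn.
by rewrite coefB coef_res_emb ?subrr.
Qed.

(** As [res] merges e_1 and e_2, all it forgets is how much of the merged coefficient belongs to
    e_1; the multiple of [e 1 - e 2] puts this back. *)
Lemma emb_res x (n1 : (1 <= n)%N) (k := Ordinal n1) :
  x = emb (res x) + x 0 k *: (e 1 - e 2).
Proof.
apply/rowP => -[[|i] hi]; rewrite !mxE /=.
  by rewrite add0r subr0 mulr1 /k; congr (x _ _); apply: val_inj.
rewrite sub0r !eqSS coef_sum (bigD1 (Ordinal hi)) //= coefZ coefXn eqxx mulr1.
case: i hi => [|i] hi.
  rewrite (bigD1 k) //= coefZ coefXn eqxx mulr1 big1 ?addr0 ?mulrN1 ?addrK //.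
  move=> l /andP[]; rewrite -!val_eqE /= coefZ coefXn.
  by case: (l : nat) => [|[|m]] // _ _; rewrite mulr0.
rewrite oppr0 mulr0 addr0 big1 ?addr0 // => l; rewrite -!val_eqE /= coefZ coefXn.
by move=> li; rewrite (_ : (i.+1 == l.-1) = false) ?mulr0 //; lia.
Qed.

Lemma res_e k : (1 <= k <= n)%N -> res (e k) = 'X^(k.-2).
Proof.
case: k => // k /andP[_ kn]; rewrite /res (bigD1 (Ordinal kn)) //= !mxE eqxx scale1r.
by rewrite big1 ?addr0 // => i /negbTE ik; rewrite mxE eqSS -[_ == k]/(i == Ordinal kn) ik scale0r.
Qed.

Lemma rmul_e k : (1 <= k <= n)%N ->
  rmul (e k) = match k with 1 => 'X | 2 => gen2 | _ => 0 end.
Proof.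
case: k => // k /andP[_ kn]; rewrite /rmul (bigD1 (Ordinal kn)) //= !mxE eqxx scale1r.
rewrite big1 ?addr0 /=; first by case: k kn => [|[|k]].
by move=> i /negbTE ik; rewrite mxE eqSS -[_ == k]/(i == Ordinal kn) ik scale0r.
Qed.

Lemma coef_gen2 j : gen2`_j = if (1 < j < n.-1)%N then alpha j.+2 else 0.
Proof. by rewrite coef_poly andbC; case: ifP. Qed.

(** Only [e_1, e_2] is not a plain multiplication: its coefficient of e_n is [theta] rather than
    that of [gen2], and [d] is the difference. *)
Lemma F1_prodE i j : (3 <= n)%N -> (1 <= i <= n)%N -> (1 <= j <= n)%N ->
  exists2 d, F1_prod n alpha theta i j =
    emb (res (e i) * rmul (e j)) + d *: e n & ((1 < i)%N -> d = 0).
Proof.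
move=> n3 hi hj; rewrite res_e ?rmul_e //.
case: j hj => [|[|[|j]]] // hj; last by exists 0; rewrite // mulr0 raddf0 scale0r addr0.
  exists 0 => //; rewrite scale0r addr0 -exprSr emb_Xn /=.
  case: i hi => [|[|i]] // hi /=.
  case: ifP => // hin; apply/rowP => k; rewrite !mxE.
  by case: k => k kn; rewrite (_ : (_ == _) = false) //=; lia.
case: i hi => [|[|i]] // hi /=.
  exists (theta - gen2`_n.-2) => //; rewrite mul1r; apply/rowP => k.
  (* At n = 3 the range starting at 4 is empty and cannot absorb the term in e_n, hence the separate
     summand. *)
  have -> : \sum_(4 <= t < n) alpha t *: e t + theta *: e n =
    \sum_(4 <= t < n.+1) (if t == n then theta else alpha t) *: e t +
     (if (n == 3)%N then theta else 0) *: e n.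
    have [->|nn3] := eqVneq n 3; first by rewrite !big_geq.
    rewrite big_nat_recr /=; last lia.
    rewrite eqxx scale0r addr0; congr (_ + _); rewrite big_nat [RHS]big_nat.
    by apply: eq_bigr => t ht; rewrite (_ : (t == n) = false) //; lia.
  rewrite mxE coef_sum_e !mxE !coef_gen2.
  case: k => -[|k] hk /=.
    by rewrite (_ : (1 == n)%N = false) ?mulr0 //; apply: ltn_eqF; exact: ltn_trans n3.
  have -> : (k.+2 == n)%N = (k == n.-2)%N by lia.
  have [-> {hk}|kn] := eqVneq k n.-2.
    have -> : (3 < n.-2.+2)%N = (n != 3)%N by lia.
    have -> : (1 < n.-2 < n.-1)%N = (n != 3)%N by lia.
    by case: eqP => //=; rewrite ?(mulr1, add0r, subr0, addr0) // => _; rewrite addrC subrK.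
  rewrite !mulr0 !addr0 (_ : (1 < k < n.-1)%N = (3 < k.+2)%N) //; lia.
exists 0 => //; rewrite scale0r addr0.
have -> : (if (1 < i.+2 <= n - 2)%N
     then \sum_(i.+2 + 2 <= t < n.+1) alpha (t - i.+2 + 2)%N *: e t else 0) =
   \sum_(i.+2 + 2 <= t < n.+1) alpha (t - i.+2 + 2)%N *: e t.
  by case: ifP => // hin; rewrite big_geq //; lia.
apply/rowP => k; rewrite coef_sum_e !mxE coefXnM coef_gen2.
case: k => -[|k] hk /=; first by [].
case: ltnP => [ki|ik]; first by rewrite ifF //; lia.
have -> : (1 < k - i < n.-1)%N = (i.+2 + 2 <= k.+2)%N by lia.
by case: ifP => // _; congr alpha; lia.
Qed.

Lemma F1E x y : (3 <= n)%N ->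
  exists2 d, br x y = emb (res x * rmul y) + d *: e n &
    ((forall k : 'I_n, k = 0%N :> nat -> x 0 k = 0) -> d = 0).
Proof.
move=> n3; have -> : emb (res x * rmul y) =
    \sum_(i < n) \sum_(j < n) (x 0 i * y 0 j) *: emb (res (e i.+1) * rmul (e j.+1)).
  rewrite {1}(e_sum x) {1}(e_sum y) !raddf_sum mulr_suml raddf_sum.
  apply: eq_bigr => i _; rewrite mulr_sumr raddf_sum; apply: eq_bigr => j _ /=.
  by rewrite !linearZ /= -scalerAl -scalerAr !linearZ /= scalerA.
set Q := fun u v => exists2 d, u = v + d *: e n &
    ((forall k : 'I_n, k = 0%N :> nat -> x 0 k = 0) -> d = 0).
have Q0 : Q 0 0 by exists 0; rewrite // scale0r addr0.
have QD u u' v v' : Q u u' -> Q v v' -> Q (u + v) (u' + v').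
  move=> [d -> d0] [d' -> d0']; exists (d + d'); first by rewrite scalerDl addrACA.
  by move=> x0; rewrite d0 // d0' // addr0.
rewrite /F1; apply: (big_ind2 Q) => // i _; apply: (big_ind2 Q) => // j _.
have [d -> d0] := @F1_prodE i.+1 j.+1 n3 (ltn_ord i) (ltn_ord j).
exists (x 0 i * y 0 j * d); first by rewrite scalerDr scalerA.
move=> x0; have [i0|i0] := posnP i; first by rewrite x0 // !mul0r.
by rewrite d0 ?mulr0.
Qed.

Lemma F1_emb p y : (3 <= n)%N -> br (emb p) y = emb (p * rmul y).
Proof.
move=> n3; have [d -> ->] := F1E (emb p) y n3.
  by rewrite scale0r addr0 emb_res_emb.
by move=> k k0; rewrite mxE k0.
Qed.

Lemma rmulE y : exists p, rmul y = p * 'X.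
Proof.
rewrite /rmul; apply: (big_ind (fun u => exists p, u = p * 'X)) => [|u v [p ->] [q ->]|i _].
- by exists 0; rewrite mul0r.
- by exists (p + q); rewrite mulrDl.
case: (val i) => [|[|k]]; last by exists 0; rewrite scaler0 mul0r.
  by exists (y 0 i)%:P; rewrite mul_polyC.
exists (y 0 i *: \poly_(j < n.-2) if (0 < j)%N then alpha j.+3 else 0).
apply/polyP => k; rewrite coefMX !coefZ coef_poly coef_poly.
case: k => [|k] /=; first by case: ifP; rewrite mulr0.
have -> : (k.+1 < n.-1)%N = (k < n.-2)%N by lia.
by case: ifP; rewrite ?mulr0.
Qed.

(** The error of the first product lies in the line of e_n, which stands for ['X^(n-2)]; the second
    right multiplication is divisible by ['X] and sends it to 0. *)
Lemma F1_F1E x y z : (3 <= n)%N -> br (br x y) z = emb (res x * rmul y * rmul z).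
Proof.
move=> n3; have [d -> _] := F1E x y n3; rewrite addrC F1_linearl F1_emb //.
have -> : e n = emb 'X^(n.-2) by rewrite emb_Xn; congr e; lia.
rewrite F1_emb // (_ : emb ('X^_ * _) = 0) ?scaler0 ?add0r //.
have [p ->] := rmulE z; apply/emb_eq0 => j jn.
by rewrite mulrA mulrAC -exprSr coefXnM ifT //; lia.
Qed.
End Model.

Section Operator.
Variables (F : fieldType) (n : nat) (alpha : nat -> F).
Local Notation A := (gen2 n alpha).
Implicit Types (x y z : 'rV[F]_n) (g p q : {poly F}).

Lemma rmul_emb g : (2 <= n)%N -> rmul alpha (emb n g) = g`_0 *: A.
Proof.
move=> n2; rewrite /rmul (bigD1 (Ordinal n2)) //= mxE /= big1 ?addr0 // => -[[|[|k]] kn] //= _.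
  by rewrite mxE /= scale0r.
by rewrite scaler0.
Qed.

Lemma rmul_res y (n2 : (2 <= n)%N) (k := Ordinal (ltnW n2)) :
  rmul alpha y = y 0 k *: 'X + ((res y)`_0 - y 0 k) *: A.
Proof.
rewrite {1}(emb_res y (ltnW n2)) linearD linearZ raddfB /= rmul_emb //.
rewrite !rmul_e ?(ltnW n2) //= -!mul_polyC polyCB; ring.
Qed.

Lemma gen2_X2 : exists A3, A = 'X^2 * A3.
Proof.
exists (drop_poly 2 A); rewrite mulrC -{1}(poly_take_drop 2 A).
rewrite (_ : take_poly 2 A = 0) ?add0r //; apply/polyP => -[|[|i]];
by rewrite coef_take_poly ?coef_gen2 coef0.
Qed.

End Operator.

(** * Pre-derivations as operators on polynomials *)

Section Dop.
Variables (F : fieldType) (d0 d1 m : {poly F}).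
Implicit Types p q g : {poly F}.

Lemma evpE p : evp p = p - 'X * odp p.
Proof. by rewrite -{2}[p]evp_odp mulrC addrK. Qed.

Lemma odpD p q : odp (p + q) = odp p + odp q.
Proof. by have := odp_linear 1 p q; rewrite !scale1r. Qed.

Lemma odpCM (k : F) p : odp (k%:P * p) = k%:P * odp p.
Proof.
by apply/polyP => i; rewrite coefCM !coef_odp coefCM; case: ifP; rewrite ?mulr0.
Qed.

(* [g] maps to [d0 g + m g'] up to a correction making ['X] go to [d1]. *)
Definition dev := d1 - m - 'X * d0.
Definition dop g := d0 * g + m * g^`() + dev * odp g.

Lemma dop_linear : linear dop.
Proof.
move=> k p q; rewrite /dop derivD derivZ odp_linear -!mul_polyC; ring.
Qed.
HB.instance Definition _ := GRing.isLinear.Build F {poly F} {poly F} _ dop dop_linear.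

Lemma dop1 : dop 1 = d0.
Proof.
rewrite /dop (_ : odp 1 = 0) ?derivC ?mulr0 ?mulr1 ?addr0 //.
by rewrite -(expr0 'X) odpXn.
Qed.

Lemma dopX : dop 'X = d1.
Proof. rewrite /dop derivX odpX /dev; ring. Qed.

Lemma evpX2 : evp 'X^2 = 'X^2 :> {poly F}.
Proof. by rewrite expr2 evpM evpX odpX; ring. Qed.

Lemma odpX2 : odp 'X^2 = 0 :> {poly F}.
Proof. by rewrite odpXn. Qed.

(** Multiplying by the even polynomial ['X^2] preserves parity, so the correction term merely
    scales. This is the shape of the relation for the triples (x, e_1, e_1). *)
Lemma dopMX2 g : dop (g * 'X^2) = dop g * 'X^2 + 2%:R * g * 'X * m.
Proof.
rewrite /dop derivM odpM evpX2 odpX2 derivXn /=; ring.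
Qed.
End Dop.

(** * Sufficiency of the polynomial relations *)

Section Characterization.
Variables (F : fieldType) (n : nat) (alpha : nat -> F) (theta : F).
Variable P : {linear 'rV[F]_n -> 'rV[F]_n}.
Local Notation br := (F1 alpha theta).
Local Notation e := (@e_ F n).
Local Notation emb := (@emb F n).
Local Notation A := (gen2 n alpha).
Implicit Types (x y z : 'rV[F]_n) (g p q : {poly F}).

(** The defect of the identity for the triple (e_2, e_1, e_2), once [P (e 2)] is known to be
    [emb d0]. *)
Definition rmul_step (d0 d1 m : {poly F}) :=
  'X * m * A^`() + dev d0 d1 m * evp A - d0`_0 *: ('X * A).

(** In order, the clauses come from comparing (e_1, e_1, e_1) with (e_2, e_1, e_1), mainly from (x,
    e_1, e_1), and then from (e_2, e_1, e_3), (e_2, e_1, e_2) and (e_3, e_1, e_2). *)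
Definition poly_prederivation (d0 d1 : {poly F}) :=
  let m := rmul alpha (P (e 1)) in
  [/\ emb ('X^2 * (res (P (e 1)) - d0)) = 0,
      forall g, P (emb g) = emb (dop d0 d1 m g),
      emb (d1`_0 *: ('X * A)) = 0,
      emb (rmul_step d0 d1 m) = 0
    & emb (dev d0 d1 m * 'X * evp A) = 0].

Hypothesis n6 : (6 <= n)%N.
Let n3 : (3 <= n)%N. Proof. exact: leq_trans n6. Qed.
Let n2 : (2 <= n)%N. Proof. exact: leq_trans n6. Qed.
Let n1 : (1 <= n)%N. Proof. exact: leq_trans n6. Qed.

Lemma emb0_coef g j : emb g = 0 -> (j.+1 < n)%N -> g`_j = 0.
Proof. by move/emb_eq0; apply. Qed.

Lemma prederivation_embE : is_prederivation br P <->
  forall x y z, P (emb (res x * rmul alpha y * rmul alpha z)) =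
    emb (res (P x) * rmul alpha y * rmul alpha z) +
    emb (res x * rmul alpha (P y) * rmul alpha z) +
    emb (res x * rmul alpha y * rmul alpha (P z)).
Proof.
by split=> H x y z; have := H x y z; rewrite !F1_F1E.
Qed.

(** Write the right multiplications by y and z as u = r X + q A and v = r' X + q' A. The defect of
    the identity is then a polynomial combination of the relations [E1], [E2], [E3]. *)
Lemma poly_prederivation_sufficient d0 d1 :
  poly_prederivation d0 d1 -> is_prederivation br P.
Proof.
set m := rmul alpha (P (e 1)).
move=> [Pe1 Pemb E1 E2 E3]; apply/prederivation_embE => x y z.
have Pe2 : P (e 2) = emb d0 by rewrite -[e 2](@emb_Xn F n 0) Pemb dop1.
have m0 : m`_0 = 0 by have [p mp] := rmulE alpha (P (e 1)); rewrite /m mp coefMX.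
have rP x' : let r := x' 0 (Ordinal n1) in
    P x' = emb (dop d0 d1 m (res x')) + r *: (P (e 1) - emb d0).
  by move=> r; rewrite {1}(emb_res x' n1) linearD /= Pemb linearZ /= raddfB /= Pe2.
(* Here [r], [q], [w] are the coordinates of [y'] along e_1, e_2, e_3. Later ones do not enter, as
   the constant coefficient of [dop d0 d1 m g] depends only on the first two coefficients of [g]. *)
have rmulP y' : exists r w : F, let q := (res y')`_0 - r in
    rmul alpha y' = r%:P * 'X + q%:P * A /\
    rmul alpha (P y') = r%:P * m + (q * d0`_0 + w * d1`_0)%:P * A.
  exists (y' 0 (Ordinal n1)), (res y')`_1; split.
    rewrite (rmul_res alpha y' n2) !mul_polyC.
    by congr (_ *: _ + (_ - _) *: _); congr (y' _ _); apply: val_inj.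
  rewrite rP linearD linearZ raddfB /= !rmul_emb // -/m -!mul_polyC.
  have -> : (dop d0 d1 m (res y'))`_0 =
      d0`_0 * (res y')`_0 + d1`_0 * (res y')`_1.
    rewrite /dop !coefD !coef0M m0 coef_odp /dev !coefB m0 coefXM /=; ring.
  rewrite !(polyCD, polyCM, polyCB); ring.
rewrite Pemb; set g := res x.
(* [P x] differs from the [emb] of [dop d0 d1 m g] by a multiple of [P (e 1) - emb d0], and the two
   right multiplications supply the factor ['X^2] required by [Pe1]. *)
have -> : emb (res (P x) * rmul alpha y * rmul alpha z) =
    emb (dop d0 d1 m g * rmul alpha y * rmul alpha z).
  rewrite rP -/g; set D := dop _ _ _ _; rewrite -!mulrA; set w := _ * rmul alpha z.
  rewrite raddfD /= linearZ /= mulrDl raddfD /= emb_res_emb -[RHS]addr0.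
  congr (_ + _); rewrite -scalerAl linearZ /= raddfB mulrBl raddfB /= emb_res_emb.
  rewrite -raddfB -mulrBl /= /w.
  have [p1 ->] := rmulE alpha y; have [p2 ->] := rmulE alpha z.
  have ring_id t : t * (p1 * 'X * (p2 * 'X)) = p1 * p2 * ('X^2 * t) by ring.
  rewrite ring_id.
  by rewrite (emb_mull _ Pe1) scaler0.
have [r [w [-> ->]]] := rmulP y; have [r' [w' [-> ->]]] := rmulP z.
move: (_`_0 - r) (_`_0 - r') => q q'.
apply/eqP; rewrite -!raddfD -subr_eq0 -raddfB /=; apply/eqP.
have [A3 AX] := gen2_X2 n alpha.
have [A4 AoX] : exists A4, odp A = 'X * A4.
  exists ('X * odp A3); rewrite AX odpM evpX2 odpX2; ring.
set u := _ + q%:P * A; set v := _ + q'%:P * A.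
have oduE : odp u = r%:P + q%:P * odp A by rewrite odpD !odpCM odpX mulr1.
have odvE : odp v = r'%:P + q'%:P * odp A by rewrite odpD !odpCM odpX mulr1.
have evuE : evp u = q%:P * evp A by rewrite !evpE oduE /u; ring.
have evvE : evp v = q'%:P * evp A by rewrite !evpE odvE /v; ring.
have duE : u^`() = r%:P + q%:P * A^`().
  by rewrite derivD !derivM !derivC derivX; ring.
have dvE : v^`() = r'%:P + q'%:P * A^`().
  by rewrite derivD !derivM !derivC derivX; ring.
(* [T2] is [g] times the derivative of u v with respect to A, divided by X, where A = X^2 A3. [T1]
   is g (w v + w' u) / X. [T3] collects what is left of the parity correction, in which [odp] of u v
   is a multiple of [evp A]. *)
pose T2 := (g * (r * q' + r' * q)%:P + 2%:R * (q * q')%:P * g * 'X * A3).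
pose T3 := 2%:R * (q * q')%:P * (A4 * (evp g - 'X * odp g) - g * A3)
   - 2%:R * (r * q' + r' * q)%:P * odp g.
pose T1 := g * (w%:P * (r'%:P + q'%:P * 'X * A3) + w'%:P * (r%:P + q%:P * 'X * A3)).
rewrite (_ : _ - _ = T2 * rmul_step d0 d1 m + T3 * (dev d0 d1 m * 'X * evp A) -
             T1 * (d1`_0 *: ('X * A))).
  by rewrite raddfB raddfD /= (emb_mull T2 E2) (emb_mull T3 E3) (emb_mull T1 E1) addr0 subr0.
rewrite /T1 /T2 /T3 /dop -/m /rmul_step -!mul_polyC.
rewrite !derivM !odpM !evpM oduE odvE evuE evvE duE dvE.
rewrite /u /v; move: (dev d0 d1 m) => k.
rewrite !(polyCM, polyCD).
have -> : evp A = A - 'X^2 * A4 by rewrite evpE AoX; ring.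
have -> : evp g = g - 'X * odp g by rewrite evpE.
rewrite AoX; move: (A^`()) => dA; rewrite AX.
move: (odp g) (g^`()) r%:P r'%:P q%:P q'%:P w%:P w'%:P (d1`_0)%:P (d0`_0)%:P.
move=> og dg rp rp' qp qp' wp wp' d1p d0p.
ring.
Qed.
End Characterization.

(** * Necessity of the polynomial relations *)

Section Necessary.
Variables (F : fieldType) (n : nat) (alpha : nat -> F) (theta : F).
Variable P : {linear 'rV[F]_n -> 'rV[F]_n}.
Local Notation br := (F1 alpha theta).
Local Notation e := (@e_ F n).
Local Notation emb := (@emb F n).
Local Notation A := (gen2 n alpha).
Implicit Types (x y z : 'rV[F]_n) (g p q : {poly F}).

Lemma poly_prederivation_necessary : (6 <= n)%N -> 2%:R != 0 :> F ->
  is_prederivation br P ->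
  poly_prederivation alpha P (res (P (e 2))) (res (P (e 3))).
Proof.
move=> n6 two; have n1 : (1 <= n)%N by exact: leq_trans n6.
have n2 : (2 <= n)%N by exact: leq_trans n6.
have n3 : (3 <= n)%N by exact: leq_trans n6.
move=> /(prederivation_embE alpha theta P n6) H.
pose d0 : {poly F} := res (P (e 2)); pose d1 : {poly F} := res (P (e 3)).
pose m : {poly F} := rmul alpha (P (e 1)).
have re1 : res (e 1) = 1 by rewrite res_e ?n1.
have re2 : res (e 2) = 1 by rewrite res_e ?n2.
have rm1 : rmul alpha (e 1) = 'X by rewrite rmul_e ?n1.
have rm2 : rmul alpha (e 2) = A by rewrite rmul_e ?n2.
have rm3 : rmul alpha (e 3) = 0 by rewrite rmul_e ?n3.
have [A3 AX] := gen2_X2 n alpha.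
have [m' mX] : exists p, m = p * 'X by apply: rmulE.
have PE x : P x = emb (res (P x)) + (P x) 0 (Ordinal n1) *: (e 1 - e 2) by apply: emb_res.
(* Right multiplication by e_3 is 0, so the triple (e_2, e_1, e_3) leaves only
   ['X * rmul alpha (P (e 3))]. Its coefficient at ['X^2] is the e_1 coordinate of [P (e 3)],
   because [A] starts in degree 2. *)
have Pe3E : P (e 3) = emb d1 /\ emb (d1`_0 *: ('X * A)) = 0.
  have := H (e 2) (e 1) (e 3).
  rewrite rm3 !mulr0 raddf0 re2 rm1 raddf0 !add0r mul1r (rmul_res _ _ n2).
  set r := P (e 3) 0 _ => /esym h0.
  have r0 : r = 0.
    have := emb0_coef h0 (leq_trans (isT : (3 < 6)%N) n6).
    by rewrite coefXM coefD !coefZ coefX AX coefXnM /= mulr0 mulr1 addr0.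
  split.
    rewrite [LHS]PE (_ : P (e 3) 0 _ = 0) ?scale0r ?addr0 // -r0.
    by congr (P _ _ _); apply: val_inj.
  by move: h0; rewrite r0 scale0r add0r subr0 -scalerAr.
have [Pe3 c2A] := Pe3E.
have dop_step g : emb (res (P (emb g)) * 'X * 'X) = emb (dop d0 d1 m g * 'X * 'X) ->
   P (emb (g * 'X^2)) = emb (dop d0 d1 m (g * 'X^2)).
  move=> hg; have := H (emb g) (e 1) (e 1).
  rewrite rm1 -!mulrA -expr2 emb_res_emb => ->; rewrite -/m !emb_res_emb.
  rewrite expr2 mulrA hg dopMX2 -!raddfD /=; congr emb; ring.
(* The exponent grows by 2, so e_3 and e_2 start the induction. For ['X^2] only [res (P (e 2))] is
   needed, which is [d0] by definition; that [P (e 2)] lies in the image of [emb] is settled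
   later. *)
have PXS k : P (emb 'X^(k.+1)) = emb (dop d0 d1 m 'X^(k.+1)).
  have [l] := ubnP k; elim: l k => // l IH [|[|k]] kl.
  - by rewrite emb_Xn expr1 dopX.
  - by rewrite -['X^2]mul1r dop_step // dop1 -(expr0 'X) emb_Xn.
  - rewrite (_ : 'X^(k.+3) = 'X^(k.+1) * 'X^2) ?dop_step //; last by rewrite -exprD addn2.
    by rewrite IH -?mulrA ?emb_res_emb //; lia.
have PX g : P (emb (g * 'X)) = emb (dop d0 d1 m (g * 'X)).
  rewrite -[g]coefK poly_def mulr_suml !raddf_sum /=; apply: eq_bigr => i _.
  by rewrite -scalerAl -exprSr !linearZ /= PXS.
have H12 g : emb (dop d0 d1 m (g * 'X * A)) =
  emb (res (P (emb g)) * 'X * A) + emb (g * m * A) + emb (g * 'X * rmul alpha (P (e 2))).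
  rewrite (mulrAC g) -PX (mulrAC g A).
  have := H (emb g) (e 1) (e 2); rewrite rm1 rm2 -/m -!mulrA.
  by rewrite !emb_res_emb.
have X1 : emb 1 = e 2 by rewrite -(expr0 'X) emb_Xn.
have evA : evp A = 'X^2 * evp A3 by rewrite AX evpM evpX2 odpX2; ring.
have dXA : dop d0 d1 m ('X * A) = d0 * 'X * A + m * (A + 'X * A^`()) + dev d0 d1 m * evp A.
  by rewrite /dop derivM derivX odpM evpX odpX; ring.
(* The constant coefficient of [dev] is that of [d1]; the coefficient of [c2A] at ['X^3] says that
   it annihilates the leading [alpha 4]. *)
have dev0 : (dev d0 d1 m)`_0 * A3`_0 = 0.
  have := emb0_coef c2A (leq_trans (isT : (4 < 6)%N) n6).
  rewrite coefZ AX coefXM coefXnM /= => h0.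
  by rewrite /dev !coefB mX coefMX coefXM /= !subr0.
(* In the relation for (e_2, e_1, e_2) the coefficient at ['X^2] isolates the e_1 coordinate [r],
   since [dev0] removes the only other term. *)
have Pe2 : P (e 2) = emb d0.
  rewrite [LHS]PE; set r := (P (e 2)) 0 _; suff -> : r = 0 by rewrite scale0r addr0.
  have := H12 1; rewrite !mul1r X1 -/d0 (rmul_res _ _ n2) -/d0.
  have -> : P (e 2) 0 (Ordinal (ltnW n2)) = r by congr (P _ _ _); apply: val_inj.
  rewrite -!raddfD /= => /emb_eqP/emb0_coef h0.
  have {h0} := h0 2%N (leq_trans (isT : (3 < 6)%N) n6).
  rewrite dXA.
  have -> : d0 * 'X * A + m * (A + 'X * A^`()) + dev d0 d1 m * evp A -
    (d0 * 'X * A + m * A + 'X * (r *: 'X + (d0`_0 - r) *: A)) =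
    'X^2 * (dev d0 d1 m * evp A3 - r%:P) +
      'X^3 * (m' * (2%:R * A3 + 'X * A3^`()) - (d0`_0 - r)%:P * A3).
    by rewrite mX evA AX derivM derivXn -!mul_polyC /=; ring.
  rewrite coefD !coefXnM /= coefB coefC coef0M coef_evp /= dev0 addr0 sub0r.
  by move/eqP; rewrite oppr_eq0 => /eqP.
have PD g : P (emb g) = emb (dop d0 d1 m g).
  have -> : g = g`_0 *: 1 + drop_poly 1 g * 'X.
    rewrite -{1}(poly_take_drop 1 g); congr (_ + _).
    apply/polyP => k; rewrite coef_take_poly coefZ coef1.
    by case: k => [|k] //=; rewrite ?mulr1 ?mulr0.
  rewrite dop_linear dop1 (linearP emb) [in RHS](linearP emb).
  by rewrite (linearP P) PX /= X1 Pe2.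
have rP2 : rmul alpha (P (e 2)) = d0`_0 *: A by rewrite Pe2 rmul_emb.
have E2 : emb (rmul_step n alpha d0 d1 m) = 0.
  have := H12 1; rewrite !mul1r X1 -/d0 rP2 dXA -!raddfD /= => /emb_eqP <-.
  by congr emb; rewrite /rmul_step -!mul_polyC; ring.
split => //.
(* As [res] takes the same value at e_1 and e_2, these two identities differ only in the term where
   [P] hits the first argument. *)
- have := H (e 1) (e 1) (e 1); have := H (e 2) (e 1) (e 1).
  rewrite rm1 re1 re2 => -> /addIr /addIr /emb_eqP.
  move=> h0; rewrite -[RHS](emb_mull (-1) h0); congr emb; rewrite -/d0; ring.
(* The triple (e_3, e_1, e_2) repeats ['X] times the previous relation up to twice the wanted
   polynomial, hence the division by 2. *)
- have := H12 'X; rewrite -!raddfD /= rP2 => /emb_eqP.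
  have -> : emb 'X = e 3 by rewrite -['X]expr1 emb_Xn.
  rewrite -/d1 => h0; have := emb_mull 'X E2.
  have -> : 'X * rmul_step n alpha d0 d1 m =
     (dop d0 d1 m ('X * 'X * A) -
        (d1 * 'X * A + 'X * m * A + 'X * 'X * (d0`_0 *: A))) +
      2%:R *: (dev d0 d1 m * 'X * evp A).
    rewrite /rmul_step /dop -!mul_polyC !(odpM, evpM, derivM) evpX odpX derivX.
    rewrite polyC_natr (evpE A) /dev; ring.
  rewrite raddfD /= h0 add0r linearZ /= => /eqP.
  by rewrite scaler_eq0 (negbTE two) => /eqP.
Qed.
End Necessary.

(** * Comparison of coefficients *)

Section Sums.
Variable V : nmodType.

Lemma sum_parity (G : nat -> V) k :
  \sum_(i < k.+1) G i =
    \sum_(0 <= s < k./2.+1) G s.*2 + \sum_(0 <= s < uphalf k) G s.*2.+1.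
Proof.
elim: k => [|k IH]; first by rewrite big_ord1 big_nat1 big_geq // addr0.
rewrite big_ord_recr /= {}IH uphalfE /=.
case: (boolP (odd k)) => ko.
  have -> : uphalf k = k./2.+1 by rewrite uphalf_half ko.
  rewrite [in RHS]big_nat_recr //= [RHS]addrAC; congr (_ + G _).
  by rewrite -[LHS](odd_double_half k.+1) /= ko uphalf_half ko add1n doubleS.
have -> : uphalf k = k./2 by rewrite uphalf_half (negbTE ko).
rewrite [X in _ = _ + X]big_nat_recr //= -addrA; congr (_ + (_ + G _.+1)).
by rewrite -{1}(odd_double_half k) (negbTE ko).
Qed.

Lemma sum_even (G : nat -> V) k :
  \sum_(i < k.+1) (if odd i then 0 else G i) = \sum_(0 <= s < k./2.+1) G s.*2.
Proof.
rewrite (sum_parity (fun i => if odd i then 0 else G i)).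
rewrite [X in _ + X]big1 ?addr0 => [|i _]; last by rewrite /= odd_double.
by apply: eq_bigr => i _; rewrite odd_double.
Qed.

Lemma sum_shift d p q (f g : nat -> V) :
    (forall s, (p <= s < q)%N -> f (s + d)%N = g s) ->
  \sum_(p + d <= t < q + d) f t = \sum_(p <= s < q) g s.
Proof. by move=> fg; rewrite big_addn addnK; apply: eq_big_nat. Qed.

End Sums.

(** * The restrictions as coefficients of the polynomial relations *)

Section Restrictions.
Variables (F : fieldType) (n : nat) (alpha : nat -> F).

(* The conditions (1)-(7); (5)-(7) form the inner conjunction. *)
Definition restrictions (a c : nat -> F) : Prop :=
  [/\ (1 + (-1) ^+ n) * c 2%N = 0
          /\ (forall t : nat, (4 <= t <= n - 1)%N -> c 2%N * alpha t = 0),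
        (a 1%N - a 2%N) * alpha 4%N = 0
          /\ (3 * a 1%N - c 3%N) * alpha 4%N = 0,
        (forall k : nat, (3 <= k <= (n - 1)./2)%N ->
          \sum_(3 <= t < k.+1)
            (a (2 * k - 2 * t + 3)%N - c (2 * k - 2 * t + 4)%N
             + a 2%N * alpha (2 * k - 2 * t + 4)%N) * alpha (2 * t - 2)%N = 0),
        (forall k : nat, (3 <= k <= n./2 - 1)%N ->
          (2 * a 1%N + a 2%N - c 3%N) * alpha (2 * k)%N
          + \sum_(3 <= t < k.+1)
              (a (2 * k - 2 * t + 4)%N - c (2 * k - 2 * t + 5)%N
               + a 2%N * alpha (2 * k - 2 * t + 5)%N) * alpha (2 * t - 2)%N = 0)
      & [/\ (forall k : nat, (5 <= k <= n - 2)%N ->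
            (a 2%N - (k - 3)%:R * a 1%N) * alpha k =
            (k - 1)%:R / 2 * a 2%N
            * \sum_(5 <= t < k.+1) alpha (t - 1)%N * alpha (k - t + 4)%N),
          (~~ odd n ->
            (a 2%N - (n - 4)%:R * a 1%N) * alpha (n - 1)%N =
            a 2%N * (\sum_(3 <= t < ((n - 2)./2).+1)
              (2 * t - 3)%:R * alpha (n - 2 * t + 3)%N * alpha (2 * t - 1)%N)
            + \sum_(2 <= t < ((n - 2)./2).+1)
                (c (n - 2 * t + 2)%N - a (n - 2 * t + 1)%N
                 + (2 * t - 3)%:R * a 2%N * alpha (n - 2 * t + 2)%N)
                * alpha (2 * t)%N)
        & (odd n ->
            (2 * a 2%N - c 3%N - (n - 6)%:R * a 1%N) * alpha (n - 1)%N =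
            a 2%N * (\sum_(3 <= t < ((n - 1)./2).+1)
              (2 * t - 3)%:R * alpha (n - 2 * t + 3)%N * alpha (2 * t - 1)%N)
            + \sum_(2 <= t < ((n - 3)./2).+1)
                (c (n - 2 * t + 2)%N - a (n - 2 * t + 1)%N
                 + (2 * t - 3)%:R * a 2%N * alpha (n - 2 * t + 2)%N)
                * alpha (2 * t)%N)]].

Local Notation A := (gen2 n alpha).
Local Notation emb := (@emb F n).

(** Indices shift by 2 because e_t stands for ['X^(t-2)]. The two top coefficients of [d0] get
    separate names since the relation between [P (e 1)] and [P (e 2)] carries a factor ['X^2] and
    misses them. *)
Definition coords (d0 d1 : {poly F}) (a b c : nat -> F) : Prop :=
  [/\ d0`_0 = a 1%N + a 2%N,
      forall j, (1 <= j)%N -> (j.+2 <= n - 2)%N -> d0`_j = a j.+2,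
      d0`_(n - 3) = b (n - 1)%N, d0`_(n - 2) = b n
    & forall j, (j <= n - 2)%N -> d1`_j = c j.+2].

Variables (d0 d1 : {poly F}) (a b c : nat -> F).
Hypotheses (n6 : (6 <= n)%N) (two : 2%:R != 0 :> F).
Hypothesis dabc : coords d0 d1 a b c.
Let m : {poly F} := a 1%N *: 'X + a 2%N *: A.
Let h : {poly F} := dev d0 d1 m.

Lemma coef_m j : m`_j = a 1%N * (j == 1%N)%:R + a 2%N * A`_j.
Proof. by rewrite coefD !coefZ coefX. Qed.

Lemma dev_coef0 : h`_0 = c 2%N.
Proof.
have [_ _ _ _ d1c] := dabc.
by rewrite !coefB coefXM coef_m d1c // coef_gen2 /= !mulr0 addr0 !subr0.
Qed.

Lemma dev_coef1 : h`_1 = c 3%N - 2 * a 1%N - a 2%N.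
Proof.
have [d00 _ _ _ d1c] := dabc.
rewrite !coefB coefXM coef_m d1c ?coef_gen2 /=; last lia.
rewrite d00; ring.
Qed.

Lemma dev_coefE j : (2 <= j <= n - 3)%N ->
  h`_j = c j.+2 - a j.+1 - a 2%N * alpha j.+2.
Proof.
move=> hj; have [_ d0a _ _ d1c] := dabc.
case: j hj => [|[|j]] // hj.
rewrite !coefB coefXM coef_m d1c ?coef_gen2 /=; last lia.
rewrite d0a ?ifT //; [ring | lia..].
Qed.

Lemma coef_dev_evp k : (k <= n - 2)%N ->
  (h * evp A)`_k = \sum_(1 <= s < k./2.+1) alpha s.*2.+2 * h`_(k - s.*2).
Proof.
move=> kn; rewrite mulrC coefM.
under eq_bigr do rewrite coef_evp.
rewrite (eq_bigr (fun j : 'I_k.+1 => if odd j then 0 else A`_j * h`_(k - j))).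
  rewrite (sum_even (fun j => A`_j * h`_(k - j))) big_ltn //.
  rewrite coef_gen2 /= mul0r add0r; apply: eq_big_nat => s hs.
  by rewrite coef_gen2 (_ : (1 < s.*2 < n.-1)%N) //; lia.
by move=> j _; case: ifP; rewrite // mul0r.
Qed.

(** [A] starts in degree 2, so two terms drop out at each end of the convolution; the rest is the
    quadratic sum of restriction (5). *)
Lemma coef_gen2_sqr k : (4 <= k <= n - 2)%N ->
  (A * A)`_(k.-1) = \sum_(5 <= t < k.+1) alpha (t - 1)%N * alpha (k - t + 4)%N.
Proof.
move=> hk; rewrite coefM prednK ?(ltn_trans _ (andP hk).1) //.
rewrite -(big_mkord xpredT (fun j => A`_j * A`_(k.-1 - j))).
rewrite (big_cat_nat (n := 2)) //=; last lia.
rewrite big_nat big1 ?add0r => [|i hi]; last by rewrite coef_gen2 ifF ?mul0r //; lia.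
rewrite (big_cat_nat (n := k - 2)) //=; try lia.
rewrite [X in _ + X](_ : _ = 0) ?addr0; last first.
  rewrite big_nat big1 // => i hi; rewrite [X in _ * X]coef_gen2 ifF ?mulr0 //; lia.
rewrite (_ : 5 = 2 + 3)%N // (_ : k.+1 = (k - 2) + 3)%N; last lia.
rewrite (sum_shift (g := fun s => A`_s * A`_(k.-1 - s))) // => s hs.
rewrite !coef_gen2 !ifT; try lia.
by congr (alpha _ * alpha _); lia.
Qed.

Lemma c2_alphaE : emb (d1`_0 *: ('X * A)) = 0 <->
  forall t, (4 <= t <= n - 1)%N -> c 2%N * alpha t = 0.
Proof.
have [_ _ _ _ d1c] := dabc; rewrite emb_eq0; split=> c2A t ht.
  have := c2A t.-1 ltac:(lia); rewrite coefZ coefXM coef_gen2 d1c //.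
  rewrite ifF ?ifT; try lia.
  by rewrite (_ : t.-2.+2 = t); last lia.
rewrite coefZ coefXM coef_gen2 d1c //.
case: t ht => [|t] ht /=; first by rewrite mulr0.
by case: ifP => ht'; rewrite ?mulr0 // c2A //; lia.
Qed.

Section WithRelation.
Hypothesis c2A : forall t, (4 <= t <= n - 1)%N -> c 2%N * alpha t = 0.

(** The summand that meets the constant coefficient of [h] is c_2 alpha_(2k), removed by [c2A]; the
    others form the sum in restriction (3). *)
Lemma coef_dev_evp_even k : (2 <= k <= (n - 1)./2)%N ->
  (h * evp A)`_(2 * k - 2) = - \sum_(3 <= t < k.+1)
            (a (2 * k - 2 * t + 3)%N - c (2 * k - 2 * t + 4)%N
             + a 2%N * alpha (2 * k - 2 * t + 4)%N) * alpha (2 * t - 2)%N.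
Proof.
case: k => [|k] // hk; rewrite coef_dev_evp; last lia.
rewrite (_ : (2 * k.+1 - 2)./2 = k)%N; last lia.
rewrite big_nat_recr /=; last lia.
rewrite (_ : 2 * k.+1 - 2 - k.*2 = 0)%N; last lia.
rewrite dev_coef0 mulrC c2A ?addr0; last lia.
rewrite (_ : k.+2 = k + 2)%N; last lia.
rewrite -sumrN; apply/esym/(@sum_shift _ 2 1 k) => s hs.
rewrite dev_coefE; last lia.
rewrite (_ : 2 * (s + 2) - 2 = s.*2.+2)%N; last lia.
rewrite (_ : 2 * k.+1 - 2 * (s + 2) + 3 = (2 * k.+1 - 2 - s.*2).+1)%N; last lia.
rewrite (_ : 2 * k.+1 - 2 * (s + 2) + 4 = (2 * k.+1 - 2 - s.*2).+2)%N; last lia.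
ring.
Qed.

(** In odd degree the last summand meets the coefficient of ['X] in [h], which gives the term of
    restriction (4) outside the sum. At k = 2 only this term remains, and it feeds restriction
    (2). *)
Lemma coef_dev_evp_odd k : (2 <= k <= n./2 - 1)%N ->
  (h * evp A)`_(2 * k - 1) = - ((2 * a 1%N + a 2%N - c 3%N) * alpha (2 * k)%N
          + \sum_(3 <= t < k.+1)
              (a (2 * k - 2 * t + 4)%N - c (2 * k - 2 * t + 5)%N
               + a 2%N * alpha (2 * k - 2 * t + 5)%N) * alpha (2 * t - 2)%N).
Proof.
case: k => [|k] // hk; rewrite coef_dev_evp; last lia.
rewrite (_ : (2 * k.+1 - 1)./2 = k)%N; last lia.
rewrite big_nat_recr /=; last lia.
rewrite (_ : 2 * k.+1 - 1 - k.*2 = 1)%N; last lia.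
rewrite (_ : 2 * k.+1 = k.*2.+2)%N; last lia.
rewrite dev_coef1 opprD addrC; congr (_ + _); first ring.
rewrite (_ : k.+2 = k + 2)%N; last lia.
rewrite -sumrN; apply/esym/(@sum_shift _ 2 1 k) => s hs.
rewrite dev_coefE; last lia.
rewrite (_ : 2 * (s + 2) - 2 = s.*2.+2)%N; last lia.
rewrite (_ : k.*2.+2 - 2 * (s + 2) + 4 = (k.*2.+2 - 1 - s.*2).+1)%N; last lia.
rewrite (_ : k.*2.+2 - 2 * (s + 2) + 5 = (k.*2.+2 - 1 - s.*2).+2)%N; last lia.
ring.
Qed.

Lemma coef_dev_evp0 : (h * evp A)`_0 = 0.
Proof. by rewrite coef_dev_evp // big_geq. Qed.

Lemma coef_dev_evp1 : (h * evp A)`_1 = 0.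
Proof. by rewrite coef_dev_evp ?big_geq //; lia. Qed.

Lemma dev_evpP : emb (h * 'X * evp A) = 0 <->
  forall k, (k <= n - 3)%N -> (h * evp A)`_k = 0.
Proof.
rewrite mulrAC emb_eq0; split=> H k hk.
  by have := H k.+1 ltac:(lia); rewrite coefMX.
by rewrite coefMX; case: k hk => // k hk; apply: H; lia.
Qed.

Lemma coef_rmul_step k : (rmul_step n alpha d0 d1 m)`_k.+1 =
  (m * A^`() - (a 1%N + a 2%N) *: A)`_k + (h * evp A)`_k.+1.
Proof.
have [d00 _ _ _ _] := dabc.
rewrite /rmul_step -/h -!mulrA d00 !coefB coefD !coefZ !coefXM /=; ring.
Qed.

Lemma coef_mA' k : (m * A^`() - (a 1%N + a 2%N) *: A)`_k =
  (k%:R * a 1%N - (a 1%N + a 2%N)) * A`_k + a 2%N * ('X * A^`() * A)`_k.+1.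
Proof.
rewrite coefB /m mulrDl coefD -!scalerAl !coefZ -mulrA !coefXM /=.
rewrite (mulrC A); case: k => [|k] /=; first ring.
rewrite coef_deriv -mulr_natr; ring.
Qed.

(** From 2 A A' = (A^2)'; this is the origin of the factor (k - 1) / 2 in restriction (5). *)
Lemma coef_derivM k : (2%:R * ('X * A^`() * A)`_k.+1) = k.+1%:R * (A * A)`_k.+1.
Proof.
rewrite -mulrA coefXM /= !mulr_natl -[RHS]coef_deriv derivM (mulrC A) -mulr2n.
by rewrite coefMn.
Qed.

Lemma coef_mA'_low k : (k < 2)%N -> (m * A^`() - (a 1%N + a 2%N) *: A)`_k = 0.
Proof.
move=> k2; rewrite coef_mA' coef_gen2 ifF ?mulr0 ?add0r; last lia.
have [A3 ->] := gen2_X2 n alpha.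
rewrite derivM derivXn (_ : _ * _ = 'X^4 * ((2%:R * A3 + 'X * A3^`()) * A3)).
  by rewrite coefXnM ifT ?mulr0 //; lia.
rewrite /=; ring.
Qed.

Lemma coef_mA'_mid k : (4 <= k <= n - 2)%N ->
  (m * A^`() - (a 1%N + a 2%N) *: A)`_(k - 2) =
  ((k - 3)%:R * a 1%N - a 2%N) * alpha k +
  (k - 1)%:R / 2 * a 2%N
            * \sum_(5 <= t < k.+1) alpha (t - 1)%N * alpha (k - t + 4)%N.
Proof.
move=> hk; rewrite coef_mA' coef_gen2 ifT; last lia.
rewrite -coef_gen2_sqr // (_ : (k - 2).+2 = k); last lia.
rewrite (_ : (k - 2).+1 = k.-1); last lia.
have := coef_derivM k.-2; rewrite (_ : k.-2.+1 = k.-1); last lia.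
rewrite (_ : k - 1 = k.-1)%N; last lia.
rewrite (_ : (k - 2)%:R = (k - 3)%:R + 1 :> F); last by rewrite natr1; congr (_%:R); lia.
move=> /(canRL (mulKf two)) ->; field; exact: two.
Qed.

(** In degree n - 2 the relation on [h * 'X * evp A] no longer makes [h * evp A] vanish. The
    convolution is therefore split by the parity of the exponent, so that its even part can be
    merged with that coefficient. *)
Lemma coef_gen2_deriv_last :
  ('X * A^`() * A)`_(n - 2) =
    \sum_(2 <= t < (n - 2)./2.+1)
      (2 * t - 2)%:R * alpha (n - 2 * t + 2)%N * alpha (2 * t)%N +
    \sum_(3 <= t < (n - 1)./2.+1)
      (2 * t - 3)%:R * alpha (n - 2 * t + 3)%N * alpha (2 * t - 1)%N.
Proof.
have A0 j : (j < 2)%N -> A`_j = 0 by move=> j2; rewrite coef_gen2 ifF //; lia.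
pose G u := u%:R * A`_u * A`_(n - 2 - u).
rewrite coefM (eq_bigr (fun u : 'I_(n - 2).+1 => G u)); last first.
  move=> [u hu] _; rewrite /G coefXM /=; case: u hu => [|u] hu /=; first by rewrite !mul0r.
  by rewrite coef_deriv mulr_natl.
rewrite (sum_parity G) uphalfE (_ : (n - 2).+1 = n - 1)%N; last lia.
congr (_ + _).
  rewrite big_ltn // {1}/G !mul0r add0r big_nat_recr /=; last lia.
  rewrite {2}/G (A0 (_ - _)%N) ?mulr0 ?addr0; last lia.
  rewrite (_ : (n - 2)./2.+1 = (n - 2)./2 + 1)%N; last lia.
  apply/esym/(@sum_shift _ 1 1) => s hs; rewrite /G !coef_gen2 !ifT; try lia.
  rewrite (_ : 2 * (s + 1) - 2 = s.*2)%N; last lia.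
  rewrite (_ : 2 * (s + 1) = s.*2.+2)%N; last lia.
  rewrite (_ : n - s.*2.+2 + 2 = (n - 2 - s.*2).+2)%N; last lia.
  ring.
rewrite big_ltn; last lia.
rewrite {1}/G (A0 1%N) // mulr0 mul0r add0r.
have [k nk] : exists k, ((n - 1)./2 = k.+2)%N by exists ((n - 1)./2 - 2)%N; lia.
rewrite nk big_nat_recr //= {2}/G (A0 (_ - _)%N) ?mulr0 ?addr0; last lia.
rewrite (_ : k.+3 = k.+1 + 2)%N; last lia.
apply/esym/(@sum_shift _ 2 1) => s hs; rewrite /G !coef_gen2 !ifT; try lia.
rewrite (_ : 2 * (s + 2) - 3 = s.*2.+1)%N; last lia.
rewrite (_ : 2 * (s + 2) - 1 = s.*2.+3)%N; last lia.
rewrite (_ : n - 2 * (s + 2) + 3 = (n - 2 - s.*2.+1).+2)%N; last lia.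
ring.
Qed.

Lemma coef_dev_evp_last : (h * evp A)`_(n - 2) =
    \sum_(2 <= t < (n - 2)./2.+1)
       (c (n - 2 * t + 2)%N - a (n - 2 * t + 1)%N
        - a 2%N * alpha (n - 2 * t + 2)%N) * alpha (2 * t)%N +
    if odd n then (c 3%N - 2 * a 1%N - a 2%N) * alpha (n - 1)%N
    else c 2%N * alpha n.
Proof.
rewrite coef_dev_evp // big_nat_recr /=; last lia.
congr (_ + _).
  rewrite (_ : (n - 2)./2.+1 = (n - 2)./2 + 1)%N; last lia.
  apply/esym/(@sum_shift _ 1 1) => s hs; rewrite dev_coefE; last lia.
  rewrite (_ : 2 * (s + 1) = s.*2.+2)%N; last lia.
  rewrite (_ : n - s.*2.+2 + 2 = (n - 2 - s.*2).+2)%N; last lia.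
  rewrite (_ : n - s.*2.+2 + 1 = (n - 2 - s.*2).+1)%N; last lia.
  ring.
case: (boolP (odd n)) => no.
  rewrite (_ : (n - 2)./2.*2.+2 = n - 1)%N; last lia.
  rewrite (_ : n - 2 - (n - 2)./2.*2 = 1)%N; last lia.
  by rewrite dev_coef1 mulrC.
rewrite (_ : (n - 2)./2.*2.+2 = n)%N; last lia.
rewrite (_ : n - 2 - (n - 2)./2.*2 = 0)%N; last lia.
by rewrite dev_coef0 mulrC.
Qed.

Lemma coef_rmul_step_last : (rmul_step n alpha d0 d1 m)`_(n - 2) =
    a 2%N * (\sum_(3 <= t < (n - 1)./2.+1)
      (2 * t - 3)%:R * alpha (n - 2 * t + 3)%N * alpha (2 * t - 1)%N) +
    \sum_(2 <= t < (n - 2)./2.+1)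
      (c (n - 2 * t + 2)%N - a (n - 2 * t + 1)%N
       + (2 * t - 3)%:R * a 2%N * alpha (n - 2 * t + 2)%N) * alpha (2 * t)%N
    - (a 2%N - (n - 4)%:R * a 1%N) * alpha (n - 1)%N +
    if odd n then (c 3%N - 2 * a 1%N - a 2%N) * alpha (n - 1)%N
    else c 2%N * alpha n.
Proof.
rewrite (_ : n - 2 = (n - 3).+1)%N; last lia.
rewrite coef_rmul_step coef_mA' coef_gen2 ifT; last lia.
rewrite (_ : (n - 3).+2 = n - 1)%N; last lia.
rewrite (_ : (n - 3).+1 = n - 2)%N; last lia.
rewrite coef_dev_evp_last coef_gen2_deriv_last.
rewrite (_ : (n - 3)%:R = (n - 4)%:R + 1 :> F); last by rewrite natr1; congr (_%:R); lia.
set tail := if _ then _ else _; set So := \sum_(3 <= t < _) _.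
(* The factor 2t - 3 is 2t - 2 from the derivative minus 1 from the term [- m] in [dev]. *)
have -> : \sum_(2 <= t < (n - 2)./2.+1)
      (c (n - 2 * t + 2)%N - a (n - 2 * t + 1)%N
       + (2 * t - 3)%:R * a 2%N * alpha (n - 2 * t + 2)%N) * alpha (2 * t)%N =
    a 2%N * (\sum_(2 <= t < (n - 2)./2.+1)
      (2 * t - 2)%:R * alpha (n - 2 * t + 2)%N * alpha (2 * t)%N) +
    \sum_(2 <= t < (n - 2)./2.+1)
       (c (n - 2 * t + 2)%N - a (n - 2 * t + 1)%N
        - a 2%N * alpha (n - 2 * t + 2)%N) * alpha (2 * t)%N.
  rewrite mulr_sumr -big_split; apply: eq_big_nat => t ht /=.
  rewrite (_ : (2 * t - 2)%:R = (2 * t - 3)%:R + 1 :> F); first by ring.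
  by rewrite natr1; congr (_%:R); lia.
ring.
Qed.
End WithRelation.

(** Up to degree n - 3, [h * evp A] vanishes: this gives (3), (4) and, in degree 3, a combination of
    the two parts of (2). In the step relation only m A' - (a_1 + a_2) A then survives up to there,
    giving the first part of (2) in degree 3 and (5) in degrees 4 to n - 3. Degree n - 2 gives (6)
    or (7). *)
Lemma restrictionsP :
  [/\ ~~ odd n -> c 2%N = 0, emb (d1`_0 *: ('X * A)) = 0,
      emb (rmul_step n alpha d0 d1 m) = 0 & emb (h * 'X * evp A) = 0]
  <-> restrictions a c.
Proof.
have E1 : (1 + (-1) ^+ n) * c 2%N = 0 <-> (~~ odd n -> c 2%N = 0).
  rewrite -signr_odd; case: (odd n) => /=; first by rewrite subrr mul0r.
  rewrite expr0 -mulr2n; split => [/eqP|c0]; last by rewrite c0 // mulr0.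
  by rewrite mulf_eq0 (negbTE two) => /eqP.
have E5 k (c2A : forall t, (4 <= t <= n - 1)%N -> c 2%N * alpha t = 0) :
    (forall j, (j <= n - 3)%N -> (h * evp A)`_j = 0) -> (4 <= k <= n - 2)%N ->
  (rmul_step n alpha d0 d1 m)`_(k - 1) = ((k - 3)%:R * a 1%N - a 2%N) * alpha k +
    (k - 1)%:R / 2 * a 2%N * \sum_(5 <= t < k.+1) alpha (t - 1)%N * alpha (k - t + 4)%N.
  move=> h0 hk; rewrite (_ : k - 1 = (k - 2).+1)%N; last lia.
  rewrite coef_rmul_step coef_mA'_mid // h0 ?addr0; last lia.
  by rewrite (_ : (k - 2).+1 = k - 1)%N; last lia.
have opp_eq0 (x : F) : - x = 0 -> x = 0 by move/eqP; rewrite oppr_eq0 => /eqP.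
split.
- move=> [c20 /c2_alphaE c2A step0 /dev_evpP h0].
  have S0 j : (j <= n - 2)%N -> (rmul_step n alpha d0 d1 m)`_j = 0.
    by move=> hj; apply: (emb0_coef step0); lia.
  have a4 : (a 1%N - a 2%N) * alpha 4%N = 0.
    have := E5 4%N c2A h0 ltac:(lia); rewrite S0; last lia.
    by rewrite big_geq // mulr0 addr0 mul1r => <-.
  split=> //; [split=> //; exact/E1 | split=> // | | | split].
  + have := @coef_dev_evp_odd 2 ltac:(lia).
    rewrite h0; last lia.
    rewrite big_geq // addr0 (_ : (2 * 2 = 4)%N) // => /esym/opp_eq0 e4.
    (* The first summand comes from the step relation, the second from [h * evp A], both in degree
       3. *)
    transitivity ((a 1%N - a 2%N) * alpha 4%N + (2 * a 1%N + a 2%N - c 3%N) * alpha 4%N).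
      by ring.
    by rewrite a4 e4 addr0.
  + by move=> k hk; apply: opp_eq0; rewrite -coef_dev_evp_even ?h0 //; lia.
  + by move=> k hk; apply: opp_eq0; rewrite -coef_dev_evp_odd ?h0 //; lia.
  + move=> k hk; have := E5 k c2A h0 ltac:(lia); rewrite S0; last lia.
    by move=> /eqP; rewrite eq_sym addrC addr_eq0 => /eqP ->; ring.
  + move=> no; have := coef_rmul_step_last; rewrite (negbTE no) c20 // mul0r addr0 S0 //.
    rewrite (_ : (n - 1)./2 = (n - 2)./2); last lia.
    by move/esym/eqP; rewrite subr_eq0 => /eqP ->.
  + move=> no; have := coef_rmul_step_last; rewrite no S0 //.
    rewrite (_ : (n - 3)./2 = (n - 2)./2); last lia.
    (* Adding the left side of (7) to both sides absorbs the tail c_3 - 2 a_1 - a_2; its 2 a_1 turns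
       n - 4 into n - 6. *)
    move=> /esym/(congr1 (+%R^~ ((2 * a 2%N - c 3%N - (n - 6)%:R * a 1%N) * alpha (n - 1)%N))).
    rewrite add0r => <-.
    rewrite (_ : (n - 4)%:R = (n - 6)%:R + 2 :> F); first by ring.
    by rewrite -natrD; congr (_%:R); lia.
- move=> [[/E1 c20 c2A] [a4 c4] r3 r4 [r5 r6 r7]].
  have h0 j : (j <= n - 3)%N -> (h * evp A)`_j = 0.
    move=> hj; have [j0|j0] := posnP j; first by rewrite j0 coef_dev_evp0.
    case: (boolP (odd j)) => oj.
      have [-> |j1] := eqVneq j 1%N; first exact: coef_dev_evp1.
      rewrite (_ : j = 2 * (j.+1)./2 - 1)%N; last lia.
      rewrite coef_dev_evp_odd //; last lia.
      have [j3|j3] := eqVneq j 3; last by rewrite r4 ?oppr0 //; lia.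
      rewrite j3 big_geq // addr0 (_ : (2 * 4./2 = 4)%N) //.
      transitivity ((a 1%N - a 2%N) * alpha 4%N - (3 * a 1%N - c 3%N) * alpha 4%N).
        by ring.
      by rewrite a4 c4 subrr.
    rewrite (_ : j = 2 * (j.+2)./2 - 2)%N; last lia.
    rewrite coef_dev_evp_even //; last lia.
    have [->|j2] := eqVneq j 2; first by rewrite big_geq ?oppr0.
    by rewrite r3 ?oppr0 //; lia.
  split=> //; [exact/c2_alphaE | | exact/dev_evpP].
  apply/emb_eq0 => j hj; have [->|j0] := posnP j.
    by rewrite /rmul_step -/h !coefB coefD coefZ -!mulrA !coefXM /= mulr0 add0r subr0 coef_dev_evp0.
  have [j3|j3] := ltnP j 3.
    by rewrite -(prednK j0) coef_rmul_step coef_mA'_low ?h0 ?addr0 //; lia.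
  have [jn|jn] := leqP j (n - 3).
    rewrite (_ : j = j.+1 - 1)%N; last lia.
    rewrite E5 //; last lia.
    have [->|j4] := eqVneq j 3.
      by rewrite big_geq // mulr0 addr0 mul1r a4.
    have := r5 j.+1 ltac:(lia) => r5j.
    by rewrite -r5j; ring.
  rewrite (_ : j = n - 2)%N; last lia.
  rewrite coef_rmul_step_last; case: (boolP (odd n)) => no.
    have := r7 no; rewrite (_ : (n - 3)./2 = (n - 2)./2); last lia.
    move=> <-; rewrite (_ : (n - 4)%:R = (n - 6)%:R + 2 :> F); first by ring.
    by rewrite -natrD; congr (_%:R); lia.
  have := r6 no; rewrite (_ : (n - 1)./2 = (n - 2)./2); last lia.
  by move=> <-; rewrite c20 // mul0r addr0 subrr.
Qed.
End Restrictions.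

(** * Reading the operator on the basis vectors *)

Lemma e_expansion (F : fieldType) n (x : 'rV[F]_n) :
  exists a : nat -> F, x = \sum_(1 <= t < n.+1) a t *: e_ n t.
Proof.
exists (fun t => if insub t.-1 is Some k then x 0 k else 0).
by apply/rowP => k; rewrite coef_sum_e /= valK.
Qed.

Lemma coef_res_expansion (F : fieldType) n (a : nat -> F) j : (j.+1 < n)%N ->
  (res (\sum_(1 <= t < n.+1) a t *: e_ n t))`_j =
    if j == 0%N then a 1%N + a 2%N else a j.+2.
Proof.
move=> jn; have n1 : (1 <= n)%N by exact: ltn_trans jn.
set x := \sum_(1 <= t < n.+1) _; have /rowP/(_ (Ordinal jn)) := emb_res x n1.
rewrite !mxE !coef_sum_e /=.
by case: j jn => [|j] jn ->; rewrite ?subr0 ?mulr0 ?addr0 //=; ring.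
Qed.

Section NormalForm.
Variables (F : fieldType) (n : nat) (alpha : nat -> F).
Variable P : {linear 'rV[F]_n -> 'rV[F]_n}.
Local Notation e := (@e_ F n).
Local Notation A := (gen2 n alpha).
Local Notation emb := (@emb F n).

Definition normal_form (a b c : nat -> F) : Prop :=
    [/\ P (e_ n 1) = \sum_(1 <= t < n.+1) a t *: e_ n t,
        P (e_ n 2) = (a 1%N + a 2%N) *: e_ n 2
          + \sum_(3 <= t < (n - 2).+1) a t *: e_ n t
          + b (n - 1)%N *: e_ n (n - 1) + b n *: e_ n n,
        P (e_ n 3) = \sum_(2 <= t < n.+1) c t *: e_ n t,
        (forall i : nat, (2 <= i <= n./2)%N ->
          P (e_ n (2 * i)) =
            ((2 * i - 1)%:R * a 1%N + a 2%N) *: e_ n (2 * i)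
            + \sum_(2 * i + 1 <= t < n.+1)
                (a (t - 2 * i + 2)%N
                 + (2 * i - 2)%:R * a 2%N * alpha (t - 2 * i + 3)%N) *: e_ n t)
      & (forall i : nat, (2 <= i <= (n - 1)./2)%N ->
          P (e_ n (2 * i + 1)) =
            c 2%N *: e_ n (2 * i)
            + ((2 * i - 2)%:R * a 1%N + c 3%N) *: e_ n (2 * i + 1)
            + \sum_(2 * i + 2 <= t < n.+1)
                (c (t - 2 * i + 2)%N
                 + (2 * i - 2)%:R * a 2%N * alpha (t - 2 * i + 2)%N) *: e_ n t)].

Variables (d0 d1 : {poly F}) (a b c : nat -> F).
Hypothesis n6 : (6 <= n)%N.
Hypothesis dabc : coords n d0 d1 a b c.
Let m : {poly F} := a 1%N *: 'X + a 2%N *: A.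

Lemma dop_even i : dop d0 d1 m 'X^(2 * i) = d0 * 'X^(2 * i) + m * 'X^((2 * i).-1) *+ (2 * i).
Proof.
rewrite /dop odpXn (_ : odd (2 * i) = false); last lia.
by rewrite mulr0 addr0 derivXn mulrnAr.
Qed.

(** The derivative yields 2i + 1 copies of [m]; the correction trades one of them, together with
    ['X * d0], for [d1]. *)
Lemma dop_odd i : dop d0 d1 m 'X^(2 * i + 1) = d1 * 'X^(2 * i) + m * 'X^(2 * i) *+ (2 * i).
Proof.
rewrite /dop odpXn (_ : odd (2 * i + 1) = true); last lia.
rewrite derivXn addn1 /= exprS /dev mulrS mulrDr mulrnAr; ring.
Qed.

Lemma emb_d0 : (a 1%N + a 2%N) *: e_ n 2
          + \sum_(3 <= t < (n - 2).+1) a t *: e_ n t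
          + b (n - 1)%N *: e_ n (n - 1) + b n *: e_ n n = emb d0.
Proof.
have [d00 d0a d0b1 d0b2 _] := dabc.
have -> : \sum_(3 <= t < (n - 2).+1) a t *: e_ n t =
   \sum_(3 <= t < n.+1) (if (t <= n - 2)%N then a t else 0) *: e_ n t.
  rewrite [RHS](big_cat_nat (n := (n - 2).+1)) /=; try lia.
  rewrite [X in _ = _ + X]big_nat [X in _ = _ + X]big1 ?addr0 => [|t ht]; last first.
    by rewrite ifF ?scale0r //; lia.
  by apply: eq_big_nat => t ht; rewrite ifT //; lia.
apply/rowP => -[k kn]; rewrite !(mxE, coef_sum_e) /=.
case: k kn => [|[|k]] kn /=.
- have -> : (1 == n - 1)%N = false by lia.
  have -> : (1 == n)%N = false by lia.
  by rewrite !mulr0 !addr0.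
- have -> : (2 == n - 1)%N = false by lia.
  have -> : (2 == n)%N = false by lia.
  by rewrite !mulr0 mulr1 !addr0 d00.
rewrite mulr0 add0r; case: ifP => kn2.
  have -> : (k.+3 == n - 1)%N = false by lia.
  have -> : (k.+3 == n)%N = false by lia.
  by rewrite !mulr0 !addr0 d0a.
have [kn1|kn1] := eqVneq k.+3 (n - 1)%N.
  have -> : (k.+3 == n)%N = false by lia.
  by rewrite mulr0 mulr1 add0r addr0 -d0b1; congr (_`_ _); lia.
have -> : (k.+3 == n)%N by lia.
by rewrite mulr0 mulr1 !add0r -d0b2; congr (_`_ _); lia.
Qed.

Lemma emb_d1 : \sum_(2 <= t < n.+1) c t *: e_ n t = emb d1.
Proof.
have [_ _ _ _ d1c] := dabc.
apply/rowP => -[[|k] kn]; rewrite !(mxE, coef_sum_e) //= d1c //; lia.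
Qed.

Lemma emb_dop_even i : (2 <= i <= n./2)%N ->
  ((2 * i - 1)%:R * a 1%N + a 2%N) *: e_ n (2 * i)
            + \sum_(2 * i + 1 <= t < n.+1)
                (a (t - 2 * i + 2)%N
                 + (2 * i - 2)%:R * a 2%N * alpha (t - 2 * i + 3)%N) *: e_ n t =
  emb (dop d0 d1 m 'X^(2 * i - 2)).
Proof.
have [d00 d0a _ _ _] := dabc.
move=> hi; rewrite (_ : 2 * i - 2 = 2 * i.-1)%N; last lia.
rewrite dop_even; apply/rowP => -[k kn]; rewrite !(mxE, coef_sum_e).
rewrite [nat_of_ord _]/=; case: k kn => [|k] kn.
  have -> : (1 == 2 * i)%N = false by lia.
  by rewrite ifF ?mulr0 ?addr0 //; lia.
rewrite [k.+1.-1]/= coefD coefMn !coefMXn (@coef_m F n alpha).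
case: (ltngtP k (2 * i.-1)) => hk.
- have -> : (k.+2 == 2 * i)%N = false by lia.
  rewrite ifF; last lia.
  rewrite mulr0 !add0r; case: ifP => hk'; first by rewrite mul0rn.
  rewrite (_ : k - (2 * i.-1).-1 = 0)%N; last lia.
  by rewrite coef_gen2 !mulr0 addr0 mul0rn.
- have -> : (k.+2 == 2 * i)%N = false by lia.
  have -> : (k < (2 * i.-1).-1)%N = false by lia.
  rewrite ifT; last lia.
  rewrite (_ : (k - (2 * i.-1).-1 == 1)%N = false); last lia.
  rewrite coef_gen2 ifT; last lia.
  rewrite d0a; try lia.
  rewrite (_ : k.+2 - 2 * i + 2 = (k - 2 * i.-1).+2)%N; last lia.
  rewrite (_ : k.+2 - 2 * i + 3 = (k - (2 * i.-1).-1).+2)%N; last lia.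
  rewrite /= !mulr0 !add0r -mulr_natl; ring.
have -> : (k.+2 == 2 * i)%N by lia.
have -> : (k < (2 * i.-1).-1)%N = false by lia.
rewrite ifF; last lia.
rewrite hk (_ : 2 * i.-1 - (2 * i.-1).-1 = 1)%N; last lia.
rewrite subnn d00 coef_gen2 /= -mulr_natl.
rewrite (_ : (2 * i - 1)%:R = (2 * i.-1)%:R + 1 :> F); first by ring.
by rewrite natr1; congr (_%:R); lia.
Qed.

Lemma emb_dop_odd i : (2 <= i <= (n - 1)./2)%N ->
            c 2%N *: e_ n (2 * i)
            + ((2 * i - 2)%:R * a 1%N + c 3%N) *: e_ n (2 * i + 1)
            + \sum_(2 * i + 2 <= t < n.+1)
                (c (t - 2 * i + 2)%N
                 + (2 * i - 2)%:R * a 2%N * alpha (t - 2 * i + 2)%N) *: e_ n t =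
  emb (dop d0 d1 m 'X^(2 * i - 1)).
Proof.
have [_ _ _ _ d1c] := dabc.
move=> hi; rewrite (_ : 2 * i - 1 = 2 * i.-1 + 1)%N; last lia.
rewrite (_ : 2 * i - 2 = 2 * i.-1)%N; last lia.
rewrite dop_odd; apply/rowP => -[k kn]; rewrite !(mxE, coef_sum_e).
rewrite [nat_of_ord _]/=; case: k kn => [|k] kn.
  have -> : (1 == 2 * i)%N = false by lia.
  have -> : (1 == 2 * i + 1)%N = false by lia.
  by rewrite ifF ?mulr0 ?addr0 //; lia.
rewrite [k.+1.-1]/= coefD coefMn !coefMXn (@coef_m F n alpha).
case: ltnP => hk.
  have -> : (k.+2 == 2 * i)%N = false by lia.
  have -> : (k.+2 == 2 * i + 1)%N = false by lia.
  rewrite ifF; last lia.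
  by rewrite /= !mulr0 mul0rn !addr0.
rewrite d1c; last lia.
have -> : (k.+2 == 2 * i)%N = (k - 2 * i.-1 == 0)%N by lia.
have -> : (k.+2 == 2 * i + 1)%N = (k - 2 * i.-1 == 1)%N by lia.
have -> : (2 * i + 2 <= k.+2)%N = (1 < k - 2 * i.-1)%N by lia.
rewrite -mulr_natl coef_gen2.
have : (k - 2 * i.-1 < n.-1)%N by lia.
rewrite (_ : k.+2 - 2 * i + 2 = (k - 2 * i.-1).+2)%N; last lia.
by case: (k - 2 * i.-1)%N => [|[|j]] /= hj; rewrite ?hj; ring.
Qed.

Hypothesis two : 2%:R != 0 :> F.

(** The values of [P] on e_2, ..., e_n fix it on the powers of ['X] below n - 1. Higher powers are 0
    under [emb], and compatibility of [dop] with this is the condition c_2 = 0 for even n. *)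
Lemma normal_formP :
    P (e_ n 1) = \sum_(1 <= t < n.+1) a t *: e_ n t ->
  (poly_prederivation alpha P d0 d1 <-> normal_form a b c /\ restrictions n alpha a c).
Proof.
move=> Pe1.
have [d00 d0a _ _ d1c] := dabc.
have mE : rmul alpha (P (e 1)) = m.
  rewrite Pe1 raddf_sum /= big_ltn; last lia.
  rewrite big_ltn; last lia.
  rewrite big_nat big1 ?addr0 => [|t ht]; rewrite linearZ /= rmul_e; try lia.
    by rewrite linearZ /= rmul_e; last lia.
  by case: t ht => [|[|[|t]]] // _; rewrite scaler0.
have Pe1d0 : emb ('X^2 * (res (P (e 1)) - d0)) = 0.
  apply/emb_eq0 => j jn; rewrite coefXnM; case: ltnP => // j2.
  rewrite coefB Pe1 coef_res_expansion; last lia.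
  by case: eqP => [->|j0]; rewrite ?d00 ?d0a ?subrr //; lia.
have PembE : (forall g, P (emb g) = emb (dop d0 d1 m g)) <->
    (forall k, (2 <= k <= n)%N -> P (e k) = emb (dop d0 d1 m 'X^(k - 2))) /\
    (~~ odd n -> c 2%N = 0).
  have m0 : m`_0 = 0 by rewrite (@coef_m F n alpha) coef_gen2 /= !mulr0 addr0.
  have eX k : (n.-1 <= k)%N -> emb 'X^k = 0.
    move=> hk; apply/emb_eq0 => j jn; rewrite coefXn (_ : (j == k) = false) //; lia.
  have mX k j : (j <= k)%N -> (m * 'X^k)`_j = 0.
    by move=> jk; rewrite coefMXn; case: ltnP => // kj; rewrite (_ : j - k = 0)%N //; lia.
  split=> [PD|[Pe c20] g].
    split=> [k hk|no]; first by rewrite -PD emb_Xn; congr (P (e _)); lia.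
    (* The power 2i + 1 = n - 1 is killed by [emb], while its image under [dop] has coefficient c_2
       in degree n - 2. *)
    have [i ni] : exists i, (n = 2 * i + 2)%N by exists (n./2).-1; lia.
    have := PD 'X^(2 * i + 1); rewrite eX ?raddf0; last lia.
    move=> /esym dop0; have := @emb0_coef _ _ _ (2 * i) dop0 ltac:(lia).
    rewrite dop_odd coefD coefMn mX ?mul0rn ?addr0 //.
    by rewrite coefMXn ltnn subnn d1c //; lia.
  have PX k : P (emb 'X^k) = emb (dop d0 d1 m 'X^k).
    have [kn|kn] := ltnP k n.-1; first by rewrite emb_Xn Pe ?subn2 //; lia.
    rewrite eX // raddf0; apply/esym/emb_eq0 => j jn.
    case: (boolP (odd k)) => ok.
      rewrite (_ : k = 2 * k./2 + 1)%N; last lia.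
      rewrite dop_odd coefD coefMn mX ?mul0rn ?addr0; last lia.
      rewrite coefMXn; case: ltnP => // kj.
      rewrite (_ : j - _ = 0)%N; last lia.
      by rewrite d1c // c20 //; lia.
    rewrite (_ : k = 2 * k./2)%N; last lia.
    rewrite dop_even coefD coefMn mX ?mul0rn ?addr0; last lia.
    by rewrite coefMXn ifT //; lia.
  rewrite -[g]coefK poly_def !raddf_sum /=; apply: eq_bigr => i _.
  by rewrite !linearZ /= PX.
rewrite /poly_prederivation mE; split.
- move=> [_ /PembE [Pe c20] E1 E2 E3]; split; last first.
    by apply/(restrictionsP alpha n6 two dabc); split.
  split=> //.
  + by rewrite emb_d0 Pe ?(dop1 d0 d1 m) //; lia.
  + by rewrite emb_d1 Pe ?(expr1, dopX d0 d1 m) //; lia.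
  + by move=> i hi; rewrite emb_dop_even // Pe //; lia.
  + move=> i hi; rewrite emb_dop_odd // Pe; last lia.
    by congr (emb (dop _ _ _ 'X^_)); lia.
- move=> [[_ Pe2 Pe3 Pev Pod] /(restrictionsP alpha n6 two dabc) [c20 E1 E2 E3]].
  split=> //; apply/PembE; split=> // k hk.
  have [->|k2] := eqVneq k 2; first by rewrite Pe2 emb_d0 subnn dop1.
  have [->|k3] := eqVneq k 3; first by rewrite Pe3 emb_d1 expr1 dopX.
  case: (boolP (odd k)) => ok.
    have := Pod k./2 ltac:(lia); rewrite emb_dop_odd; last lia.
    rewrite (_ : 2 * k./2 + 1 = k)%N; last lia.
    by rewrite (_ : 2 * k./2 - 1 = k - 2)%N //; lia.
  have := Pev k./2 ltac:(lia); rewrite emb_dop_even; last lia.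
  by rewrite (_ : 2 * k./2 = k)%N //; lia.
Qed.
End NormalForm.

Lemma prederivationP (F : fieldType) (n : nat) (alpha : nat -> F) (theta : F)
    (P : {linear 'rV[F]_n -> 'rV[F]_n}) :
    (6 <= n)%N -> 2%:R != 0 :> F ->
  is_prederivation (F1 alpha theta) P <->
  exists a b c, normal_form alpha P a b c /\ restrictions n alpha a c.
Proof.
move=> n6 two; split=> [Pder|[a [b [c [Pabc rel]]]]]; last first.
  pose d0 : {poly F} := \poly_(j < n.-1) if j == 0%N then a 1%N + a 2%N
    else if (j.+2 <= n - 2)%N then a j.+2 else b j.+2.
  pose d1 : {poly F} := \poly_(j < n.-1) c j.+2.
  have dabc : coords n d0 d1 a b c.
    split=> [|j j1 jn|||j jn]; rewrite coef_poly ifT //; try lia.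
    - by rewrite ifF ?ifT //; lia.
    - by rewrite !ifF; [congr b; lia | lia..].
    - by rewrite !ifF; [congr b; lia | lia..].
  have Pe1 : P (e_ n 1) = \sum_(1 <= t < n.+1) a t *: e_ n t by case: Pabc.
  apply: (@poly_prederivation_sufficient _ _ _ theta _ n6 d0 d1).
  exact/(normal_formP alpha n6 dabc two Pe1).
have PP := poly_prederivation_necessary n6 two Pder.
set d0 := res (P (e_ n 2)) in PP; set d1 := res (P (e_ n 3)) in PP.
have [a Pe1] := e_expansion (P (e_ n 1)).
exists a, (fun t => d0`_(t - 2)), (fun t => d1`_(t - 2)).
apply/(normal_formP (d0 := d0) (d1 := d1) alpha n6 _ two Pe1) => //.
(* The factor ['X^2] in the first clause of [PP] makes [P (e 1)] and [P (e 2)] agree up to degree n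
   - 4 only; the two coefficients above are left to b. *)
have d0E j : (j.+2 <= n - 2)%N -> d0`_j = if j == 0%N then a 1%N + a 2%N else a j.+2.
  move=> jn; case: PP => e0 _ _ _ _; have := @emb0_coef _ _ _ j.+2 e0.
  rewrite coefXnM ltnNge /= coefB Pe1 coef_res_expansion; last lia.
  by rewrite subn2 /= => /(_ ltac:(lia))/eqP; rewrite subr_eq0 => /eqP.
split=> [|j j1 jn|||j jn].
- by rewrite d0E //; lia.
- by rewrite d0E ?ifF //; lia.
- by rewrite -subnDA.
- by [].
- by rewrite subn2.
Qed.

Unset Implicit Arguments.

Theorem proposition3p1 (R : realType) (n : nat) (hn : (6 <= n)%N)
    (alpha : nat -> R[i]) (theta : R[i])
    (P : {linear 'rV[R[i]]_n -> 'rV[R[i]]_n}) :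
  is_prederivation (@F1 _ n alpha theta) P <->
  exists a b c : nat -> R[i],
    [/\ P (e_ n 1) = \sum_(1 <= t < n.+1) a t *: e_ n t,
        P (e_ n 2) = (a 1%N + a 2%N) *: e_ n 2
          + \sum_(3 <= t < (n - 2).+1) a t *: e_ n t
          + b (n - 1)%N *: e_ n (n - 1) + b n *: e_ n n,
        P (e_ n 3) = \sum_(2 <= t < n.+1) c t *: e_ n t,
        (forall i : nat, (2 <= i <= n./2)%N ->
          P (e_ n (2 * i)) =
            ((2 * i - 1)%:R * a 1%N + a 2%N) *: e_ n (2 * i)
            + \sum_(2 * i + 1 <= t < n.+1)
                (a (t - 2 * i + 2)%N
                 + (2 * i - 2)%:R * a 2%N * alpha (t - 2 * i + 3)%N) *: e_ n t)
      & (forall i : nat, (2 <= i <= (n - 1)./2)%N ->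
          P (e_ n (2 * i + 1)) =
            c 2%N *: e_ n (2 * i)
            + ((2 * i - 2)%:R * a 1%N + c 3%N) *: e_ n (2 * i + 1)
            + \sum_(2 * i + 2 <= t < n.+1)
                (c (t - 2 * i + 2)%N
                 + (2 * i - 2)%:R * a 2%N * alpha (t - 2 * i + 2)%N) *: e_ n t)]
    /\ [/\ (* (1) *)
        (1 + (-1) ^+ n) * c 2%N = 0
          /\ (forall t : nat, (4 <= t <= n - 1)%N -> c 2%N * alpha t = 0),
        (* (2) *)
        (a 1%N - a 2%N) * alpha 4%N = 0
          /\ (3 * a 1%N - c 3%N) * alpha 4%N = 0,
        (* (3) *)
        (forall k : nat, (3 <= k <= (n - 1)./2)%N ->
          \sum_(3 <= t < k.+1)
            (a (2 * k - 2 * t + 3)%N - c (2 * k - 2 * t + 4)%N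
             + a 2%N * alpha (2 * k - 2 * t + 4)%N) * alpha (2 * t - 2)%N = 0),
        (* (4) *)
        (forall k : nat, (3 <= k <= n./2 - 1)%N ->
          (2 * a 1%N + a 2%N - c 3%N) * alpha (2 * k)%N
          + \sum_(3 <= t < k.+1)
              (a (2 * k - 2 * t + 4)%N - c (2 * k - 2 * t + 5)%N
               + a 2%N * alpha (2 * k - 2 * t + 5)%N) * alpha (2 * t - 2)%N = 0)
      & [/\ (* (5) *)
          (forall k : nat, (5 <= k <= n - 2)%N ->
            (a 2%N - (k - 3)%:R * a 1%N) * alpha k =
            (k - 1)%:R / 2 * a 2%N
            * \sum_(5 <= t < k.+1) alpha (t - 1)%N * alpha (k - t + 4)%N),
          (* (6) *)
          (~~ odd n ->
            (a 2%N - (n - 4)%:R * a 1%N) * alpha (n - 1)%N =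
            a 2%N * (\sum_(3 <= t < ((n - 2)./2).+1)
              (2 * t - 3)%:R * alpha (n - 2 * t + 3)%N * alpha (2 * t - 1)%N)
            + \sum_(2 <= t < ((n - 2)./2).+1)
                (c (n - 2 * t + 2)%N - a (n - 2 * t + 1)%N
                 + (2 * t - 3)%:R * a 2%N * alpha (n - 2 * t + 2)%N)
                * alpha (2 * t)%N)
        & (* (7) *)
          (odd n ->
            (2 * a 2%N - c 3%N - (n - 6)%:R * a 1%N) * alpha (n - 1)%N =
            a 2%N * (\sum_(3 <= t < ((n - 1)./2).+1)
              (2 * t - 3)%:R * alpha (n - 2 * t + 3)%N * alpha (2 * t - 1)%N)
            + \sum_(2 <= t < ((n - 3)./2).+1)
                (c (n - 2 * t + 2)%N - a (n - 2 * t + 1)%N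
                 + (2 * t - 3)%:R * a 2%N * alpha (n - 2 * t + 2)%N)
                * alpha (2 * t)%N)]].
Proof.
apply: prederivationP => //.
by rewrite Num.Theory.pnatr_eq0.
Qed.
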